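(* Let $T$ be the disjoint union of complete theories $T_1$ and $T_2$ in disjoint languages, where $I(T_1,\omega)$ and $I(T_2,\omega)$ are finite. Then: (1) ${\rm LRK}(T)$ is a lattice if and only if ${\rm LRK}(T_1)$ and ${\rm LRK}(T_2)$ are lattices; and ${\rm LRK}(T)$ is a Boolean lattice if and only if ${\rm LRK}(T_1)$ and ${\rm LRK}(T_2)$ are Boolean lattices; (2) ${\rm LRK}(T)$ is linearly ordered if and only if ${\rm LRK}(T_1)$ and ${\rm LRK}(T_2)$ are linearly ordered and $\min\{I(T_1,\omega),I(T_2,\omega)\}=1$.
   Context: $I(T,\omega)$ is the number of pairwise non-isomorphic countable models of $T$. The disjoint union of $T_1$ and $T_2$ (in disjoint languages) is the theory whose models are disjoint unions $\mathcal{M}_1\sqcup\mathcal{M}_2$ of a model $\mathcal{M}_1\models T_1$ and a model $\mathcal{M}_2\models T_2$ (with the two parts distinguished by unary predicates, each symbol interpreted on its own part). ${\rm RK}(T)$ is the Rudin–Keisler preorder on isomorphism types of models of $T$ that are prime over finite sets: $\widetilde{\mathcal{M}}\leq_{\rm RK}\widetilde{\mathcal{N}}$ iff $\mathcal{M}$ is elementarily embeddable into $\mathcal{N}$; ${\rm LRK}(T)$ is the partially ordered set obtained by factoring this preorder by its induced equivalence.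
   Formalization: The languages of T_1 and T_2 are assumed countable (the usual convention for I(T,ω)); for uncountable languages a complete theory may have no countable model, I=0, and (2) fails. *)

(* Defs.v *)
From HB Require Import structures.
From mathcomp Require Import all_boot all_order.
From mathcomp Require Import finmap.
From mathcomp Require Import boolp classical_sets functions cardinality.

Set Implicit Arguments.
Unset Strict Implicit.
Unset Printing Implicit Defensive.

Import Order.TTheory.
Local Open Scope classical_set_scope.
Local Open Scope fset_scope.
Local Open Scope quotient_scope.

(* Constants are the function symbols of arity 0. *)
Record language := Language {
  fun_sym : Type;
  fun_ar : fun_sym -> nat;
  rel_sym : Type;
  rel_ar : rel_sym -> nat }.

Definition countable_language (L : language) : Prop :=
  countable [set: fun_sym L] /\ countable [set: rel_sym L].

Record structure (L : language) := Structure {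
  carrier :> Type;
  carrier_inhabited : inhabited carrier;
  fun_int : forall f : fun_sym L, ('I_(fun_ar f) -> carrier) -> carrier;
  rel_int : forall r : rel_sym L, ('I_(rel_ar r) -> carrier) -> Prop }.
Arguments fun_int {L} s f _.
Arguments rel_int {L} s r _.

(* Terms and formulas whose free variables are among x_0, ..., x_(n-1). *)
Inductive term (L : language) (n : nat) : Type :=
| TVar of 'I_n
| TFun (f : fun_sym L) of 'I_(fun_ar f) -> term L n.

Inductive formula (L : language) : nat -> Type :=
| FBot n : formula L n
| FEq n : term L n -> term L n -> formula L n
| FRel n (r : rel_sym L) : ('I_(rel_ar r) -> term L n) -> formula L n
| FImp n : formula L n -> formula L n -> formula L n
| FAll n : formula L n.+1 -> formula L n.

Definition FNot (L : language) n (phi : formula L n) : formula L n :=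
  FImp phi (FBot L n).

(* The valuation (x, v_0, ..., v_(n-1)): a quantifier binds the variable 0 and
   shifts the other ones. *)
Definition vcons (X : Type) n (x : X) (v : 'I_n -> X) (i : 'I_n.+1) : X :=
  oapp v x (unlift ord0 i).

Section Semantics.
Variables (L : language) (M : structure L).

Fixpoint eval n (v : 'I_n -> M) (t : term L n) : M :=
  match t with
  | TVar i => v i
  | TFun f ts => fun_int M f (fun i => eval v (ts i))
  end.

Fixpoint sat n (phi : formula L n) : ('I_n -> M) -> Prop :=
  match phi in formula _ n return ('I_n -> M) -> Prop with
  | FBot _ => fun=> False
  | FEq _ s t => fun v => eval v s = eval v t
  | FRel _ r ts => fun v => rel_int M r (fun i => eval v (ts i))
  | FImp _ phi psi => fun v => sat phi v -> sat psi v
  | FAll _ phi => fun v => forall x : M, sat phi (vcons x v)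
  end.

End Semantics.
Arguments sat {L} M {n} phi v.
Arguments eval {L} M {n} v t.

Definition sentence (L : language) := formula L 0.
Definition theory (L : language) := set (sentence L).

(* There is exactly one v : 'I_0 -> M. *)
Definition holds (L : language) (M : structure L) (phi : sentence L) : Prop :=
  forall v : 'I_0 -> M, sat M phi v.

Definition models (L : language) (M : structure L) (T : theory L) : Prop :=
  forall phi, T phi -> holds M phi.

Definition entails (L : language) (T : theory L) (phi : sentence L) : Prop :=
  forall M : structure L, models M T -> holds M phi.

Definition complete_theory (L : language) (T : theory L) : Prop :=
  (exists M : structure L, models M T) /\
  forall phi, entails T phi \/ entails T (FNot phi).

Definition isomorphism (L : language) (M N : structure L) (f : M -> N) : Prop :=
  [/\ bijective f,
      forall (g : fun_sym L) (x : 'I_(fun_ar g) -> M),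
        f (fun_int M g x) = fun_int N g (f \o x)
    & forall (r : rel_sym L) (x : 'I_(rel_ar r) -> M),
        rel_int M r x <-> rel_int N r (f \o x)].

Definition isomorphic (L : language) (M N : structure L) : Prop :=
  exists f : M -> N, isomorphism f.

Definition elementary (L : language) (M N : structure L) (f : M -> N) : Prop :=
  forall n (phi : formula L n) (v : 'I_n -> M),
    sat M phi v <-> sat N phi (f \o v).

Definition elem_embeddable (L : language) (M N : structure L) : Prop :=
  exists f : M -> N, elementary f.

(* Only the values of f on A matter. The case n = 0 says that M and N are
   elementarily equivalent. *)
Definition partial_elementary (L : language) (M N : structure L)
    (A : set M) (f : M -> N) : Prop :=
  forall n (phi : formula L n) (v : 'I_n -> M), (forall i, A (v i)) ->
    (sat M phi v <-> sat N phi (f \o v)).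

Definition prime_over (L : language) (M : structure L) (A : set M) : Prop :=
  forall (N : structure L) (f : M -> N), partial_elementary A f ->
    exists2 g : M -> N, elementary g & forall a, A a -> g a = f a.

Definition prime_over_finite (L : language) (T : theory L) (M : structure L) :
    Prop :=
  models M T /\ exists2 A : set M, finite_set A & prime_over A.

(* "Countable" means finite or countably infinite, so that a complete theory
   with a finite model has exactly one countable model up to isomorphism. *)
Definition countable_model (L : language) (T : theory L) (M : structure L) :
    Prop :=
  models M T /\ countable [set: M].

Section BasicFacts.
Variable L : language.
Implicit Types M N P : structure L.

Lemma comp_vcons (X Y : Type) n (f : X -> Y) (x : X) (v : 'I_n -> X) :
  f \o vcons x v = vcons (f x) (f \o v).
Proof. by apply/funext => i; rewrite /vcons /=; case: (unlift _ _). Qed.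

Lemma isomorphic_refl M : isomorphic M M.
Proof. by exists id; split => //; exists id. Qed.

Lemma isomorphic_sym M N : isomorphic M N -> isomorphic N M.
Proof.
move=> [f [[g fK gK] ff fr]]; exists g; split.
- by exists f.
- move=> h x; rewrite -[RHS]fK ff.
  by congr (g (fun_int N h _)); apply/funext => i /=; rewrite gK.
- move=> r x; rewrite fr; suff -> : f \o (g \o x) = x by [].
  by apply/funext => i /=; rewrite gK.
Qed.

Lemma isomorphic_trans M N P :
  isomorphic M N -> isomorphic N P -> isomorphic M P.
Proof.
move=> [f [fbij ff fr]] [g [gbij gf gr]]; exists (g \o f); split.
- exact: bij_comp.
- by move=> h x; rewrite /= ff gf.
- by move=> r x; rewrite fr gr.
Qed.

Lemma eval_iso M N (f : M -> N) : isomorphism f ->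
  forall n (v : 'I_n -> M) (t : term L n), f (eval M v t) = eval N (f \o v) t.
Proof.
move=> [_ ff _] n v; elim=> [//|g ts IH] /=; rewrite ff.
by congr (fun_int N g _); apply/funext => i /=; rewrite IH.
Qed.

Lemma isomorphism_elementary M N (f : M -> N) : isomorphism f -> elementary f.
Proof.
move=> fiso; have [[g fK gK] _ fr] := fiso.
move=> n phi v; elim: n / phi v => /= [|n s t|n r ts|n p IHp q IHq|n p IH] v.
- by [].
- rewrite -!(eval_iso fiso); split=> [-> //|]; exact: can_inj.
- rewrite fr; suff -> : f \o (fun i => eval M v (ts i)) =
    (fun i => eval N (f \o v) (ts i)) by [].
  by apply/funext => i /=; rewrite (eval_iso fiso).
- by rewrite IHp IHq.
- split=> H x; first by rewrite -(gK x) -comp_vcons; apply/IH.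
  by apply/IH; rewrite comp_vcons.
Qed.

Lemma elem_embeddable_trans M N P :
  elem_embeddable M N -> elem_embeddable N P -> elem_embeddable M P.
Proof.
move=> [f fel] [g gel]; exists (g \o f) => n phi v.
by rewrite fel gel.
Qed.

Lemma iso_elem_embeddable M N : isomorphic M N -> elem_embeddable M N.
Proof. by move=> [f fiso]; exists f; exact: isomorphism_elementary. Qed.

End BasicFacts.

Definition structures (L : language) (P : structure L -> Prop) : Type :=
  {M : structure L | P M}.

HB.instance Definition _ (L : language) (P : structure L -> Prop) :=
  gen_eqMixin (structures P).
HB.instance Definition _ (L : language) (P : structure L -> Prop) :=
  gen_choiceMixin (structures P).

Section IsoTypes.
Variables (L : language) (P : structure L -> Prop).

Definition iso_rel : rel (structures P) :=
  fun M N => `[< isomorphic (sval M) (sval N) >].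

Lemma iso_rel_refl : reflexive iso_rel.
Proof. by move=> M; apply/asboolP; exact: isomorphic_refl. Qed.

Lemma iso_rel_sym : symmetric iso_rel.
Proof.
by move=> M N; apply/asboolP/asboolP; exact: isomorphic_sym.
Qed.

Lemma iso_rel_trans : transitive iso_rel.
Proof.
move=> N M K /asboolP MN /asboolP NK; apply/asboolP.
exact: isomorphic_trans MN NK.
Qed.

Canonical iso_equiv := EquivRel iso_rel iso_rel_refl iso_rel_sym iso_rel_trans.

Definition iso_types := {eq_quot iso_equiv}.

End IsoTypes.

Definition countable_iso_types (L : language) (T : theory L) : Type :=
  iso_types (countable_model T).

Definition finite_I (L : language) (T : theory L) : Prop :=
  finite_set [set: countable_iso_types T].

(* I(T, omega) when [finite_I T] holds; 0 otherwise. *)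
Definition I_omega (L : language) (T : theory L) : nat :=
  #|` fset_set [set: countable_iso_types T]|.

Definition RK (L : language) (T : theory L) : Type :=
  iso_types (prime_over_finite T).

Section RudinKeisler.
Variables (L : language) (T : theory L).

(* RK_le and LRK_le compare representatives; by RK_leP and LRK_leE the choice of
   these does not matter. *)
Definition RK_le : rel (RK T) :=
  fun X Y => `[< elem_embeddable (sval (repr X)) (sval (repr Y)) >].

Lemma RK_leP (M N : structures (prime_over_finite T)) :
  RK_le (\pi_(RK T) M) (\pi_(RK T) N) <-> elem_embeddable (sval M) (sval N).
Proof.
have iso_repr (K : structures (prime_over_finite T)) :
    isomorphic (sval (repr (\pi_(RK T) K))) (sval K).
  apply/asboolP; rewrite -/(iso_rel _ _).
  by apply/(@eqquotP _ (@iso_rel _ _) (RK T)); rewrite reprK.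
split=> [/asboolP MN|MN]; last apply/asboolP.
- apply: elem_embeddable_trans (iso_elem_embeddable (iso_repr N)).
  apply: elem_embeddable_trans _ MN.
  exact/iso_elem_embeddable/isomorphic_sym/iso_repr.
- apply: elem_embeddable_trans (iso_elem_embeddable (iso_repr M)) _.
  apply: elem_embeddable_trans MN _.
  exact/iso_elem_embeddable/isomorphic_sym/iso_repr.
Qed.

Lemma RK_le_refl : reflexive RK_le.
Proof.
by move=> X; apply/asboolP; exact/iso_elem_embeddable/isomorphic_refl.
Qed.

Lemma RK_le_trans : transitive RK_le.
Proof.
move=> Y X Z /asboolP XY /asboolP YZ; apply/asboolP.
exact: elem_embeddable_trans XY YZ.
Qed.

Definition RK_eqv : rel (RK T) := fun X Y => RK_le X Y && RK_le Y X.

Lemma RK_eqv_refl : reflexive RK_eqv.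
Proof. by move=> X; rewrite /RK_eqv RK_le_refl. Qed.

Lemma RK_eqv_sym : symmetric RK_eqv.
Proof. by move=> X Y; rewrite /RK_eqv andbC. Qed.

Lemma RK_eqv_trans : transitive RK_eqv.
Proof.
move=> Y X Z /andP[XY YX] /andP[YZ ZY]; apply/andP; split.
- exact: RK_le_trans XY YZ.
- exact: RK_le_trans ZY YX.
Qed.

Canonical RK_equiv := EquivRel RK_eqv RK_eqv_refl RK_eqv_sym RK_eqv_trans.

Definition LRK := {eq_quot RK_equiv}.
HB.instance Definition _ := Choice.on LRK.

Definition LRK_le : rel LRK := fun x y => RK_le (repr x) (repr y).

Lemma LRK_leE (X Y : RK T) : LRK_le (\pi_LRK X) (\pi_LRK Y) = RK_le X Y.
Proof.
have eqv_repr (Z : RK T) : RK_eqv (repr (\pi_LRK Z)) Z.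
  by apply/(@eqquotP _ RK_eqv LRK); rewrite reprK.
have /andP[rX Xr] := eqv_repr X; have /andP[rY Yr] := eqv_repr Y.
apply/idP/idP => XY.
- by apply: RK_le_trans rY; apply: RK_le_trans XY.
- by apply: RK_le_trans Yr; apply: RK_le_trans XY.
Qed.

Lemma LRK_le_refl : reflexive LRK_le.
Proof. by move=> x; exact: RK_le_refl. Qed.

Lemma LRK_le_anti : antisymmetric LRK_le.
Proof.
move=> x y xy; rewrite -(reprK x) -(reprK y).
exact/(@eqquotP _ RK_eqv LRK).
Qed.

Lemma LRK_le_trans : transitive LRK_le.
Proof. by move=> y x z; exact: RK_le_trans. Qed.

End RudinKeisler.

Fact LRK_display : Order.disp_t. Proof. exact: Order.Disp tt tt. Qed.

HB.instance Definition _ (L : language) (T : theory L) :=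
  Order.Le_isPOrder.Build LRK_display (LRK T)
    (@LRK_le_refl L T) (@LRK_le_anti L T) (@LRK_le_trans L T).

Section PosetProperties.
Context {d : Order.disp_t} (P : porderType d).
Local Open Scope order_scope.

Definition is_meet (x y z : P) : Prop :=
  [/\ z <= x, z <= y & forall w, w <= x -> w <= y -> w <= z].

Definition is_join (x y z : P) : Prop :=
  [/\ x <= z, y <= z & forall w, x <= w -> y <= w -> z <= w].

Definition is_lattice : Prop :=
  forall x y : P, (exists z, is_meet x y z) /\ (exists z, is_join x y z).

(* A bounded distributive complemented lattice. *)
Definition is_boolean_lattice : Prop :=
  exists (meet join : P -> P -> P) (bot top : P),
    [/\ forall x y, is_meet x y (meet x y) /\ is_join x y (join x y),
        forall x, bot <= x <= top,
        forall x y z, meet x (join y z) = join (meet x y) (meet x z)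
      & forall x, exists y, meet x y = bot /\ join x y = top].

Definition linearly_ordered : Prop := total (<=%O : rel P).

End PosetProperties.

(* The language of the disjoint union: that of the two languages, plus a unary
   predicate for each part. A function symbol is a partial operation on a
   disjoint union; it is represented by its graph, a relation symbol whose
   argument 0 is the value and whose arguments 1, ..., n are the arguments of
   the operation. *)

Inductive du_sym (L1 L2 : language) : Type :=
| DPart1
| DPart2
| DRel1 of rel_sym L1
| DRel2 of rel_sym L2
| DGraph1 of fun_sym L1
| DGraph2 of fun_sym L2.

Definition du_ar (L1 L2 : language) (s : du_sym L1 L2) : nat :=
  match s with
  | DPart1 | DPart2 => 1
  | DRel1 r => rel_ar r
  | DRel2 r => rel_ar r
  | DGraph1 f => (fun_ar f).+1
  | DGraph2 f => (fun_ar f).+1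
  end.

Definition du_language (L1 L2 : language) : language :=
  @Language void (fun=> 0%N) (du_sym L1 L2) (@du_ar L1 L2).

Section DisjointUnion.
Variables (L1 L2 : language) (M1 : structure L1) (M2 : structure L2).

Definition du_int (s : du_sym L1 L2) : ('I_(du_ar s) -> M1 + M2) -> Prop :=
  match s return ('I_(du_ar s) -> M1 + M2) -> Prop with
  | DPart1 => fun x => exists a, x ord0 = inl a
  | DPart2 => fun x => exists b, x ord0 = inr b
  | DRel1 r => fun x => exists2 y, x = inl \o y & rel_int M1 r y
  | DRel2 r => fun x => exists2 y, x = inr \o y & rel_int M2 r y
  | DGraph1 f => fun x => exists y, x = inl \o vcons (fun_int M1 f y) y
  | DGraph2 f => fun x => exists y, x = inr \o vcons (fun_int M2 f y) y
  end.

Lemma du_inhabited : inhabited (M1 + M2).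
Proof. by case: (carrier_inhabited M1) => a; exists; left. Qed.

Definition du_structure : structure (du_language L1 L2) :=
  @Structure (du_language L1 L2) (M1 + M2)%type du_inhabited
    (fun f : void => match f with end) du_int.

End DisjointUnion.

(* The theory of the class of all disjoint unions of a model of T1 and a model
   of T2. *)
Definition du_theory (L1 L2 : language) (T1 : theory L1) (T2 : theory L2) :
    theory (du_language L1 L2) :=
  [set phi | forall (M1 : structure L1) (M2 : structure L2),
    models M1 T1 -> models M2 T2 -> holds (du_structure M1 M2) phi].

(* Main.v *)
Require Import Defs.
From mathcomp Require Import all_boot all_order.
From mathcomp Require Import boolp classical_sets functions cardinality filter.

(* Taking disjoint unions is an order isomorphism from LRK(T1) x LRK(T2) onto
   LRK(T). Relativization shows that every model of T is a disjoint union of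
   models of T1 and T2 and that elementary maps between disjoint unions split
   into elementary maps of the two parts; the Feferman-Vaught decomposition of
   formulas gives the converse. Hence a disjoint union is prime over a finite
   set iff both of its parts are.

   It remains to compare with the poset properties of a product, which needs
   that LRK(Ti) is nonempty, and that it is a singleton iff I(Ti, omega) = 1.
   When I(T, omega) is finite, T has countably many types of finite tuples; by
   an ultrapower argument isolated types over a finite tuple are then dense, so
   every finite tuple lies in a countable elementary submodel that is atomic,
   hence prime, over it. If LRK(T) is a singleton, the submodel prime over a
   tuple b of a countable model N embeds into the prime model, so the type of b
   is isolated; thus N is atomic, and isomorphic to the prime model by back and
   forth. *)

Set Implicit Arguments.
Unset Strict Implicit.
Unset Printing Implicit Defensive.

Import Order.TTheory.
Local Open Scope classical_set_scope.
Local Open Scope quotient_scope.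

(** * Products of posets *)

(** Equality in [LRK] is mutual embeddability, a priori weaker than isomorphism, so a trivial [LRK]
    does not by itself bound the number of countable models. The link is that a mere embedding into
    the prime model already forces types to be isolated. The number 1 in the linear case comes from
    the fact that two factors with more than one point each produce an antichain in the product.
    Nonemptiness of both factors carries real content: an empty factor would make the product empty,
    and its properties would say nothing of the other factor. It amounts to the existence of prime
    models, and this is where finiteness of I(T, omega) enters. That finiteness concerns countable
    models only, so it controls types through the Löwenheim-Skolem theorem, hence through countable
    languages. Isolation over a tuple is expressed by a formula without parameters, compared only
    among tuples that share the given subtuple. Thus only types over the empty set have to be
    counted. *)

Section MeetJoin.
Local Open Scope order_scope.
Context {d : Order.disp_t} {P : porderType d}.
Implicit Types x y z : P.

Lemma is_meet_uniq x y z z' : is_meet x y z -> is_meet x y z' -> z = z'.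
Proof.
by move=> [zx zy zP] [z'x z'y z'P]; apply/le_anti; rewrite z'P ?zP.
Qed.

Lemma is_join_uniq x y z z' : is_join x y z -> is_join x y z' -> z = z'.
Proof.
by move=> [zx zy zP] [z'x z'y z'P]; apply/le_anti; rewrite zP ?z'P.
Qed.

End MeetJoin.

Section ProductOrder.
Local Open Scope order_scope.
Context {d d1 d2 : Order.disp_t}.
Variables (P : porderType d) (P1 : porderType d1) (P2 : porderType d2).
Variable mk : P1 -> P2 -> P.
Hypothesis mk_le : forall x y x' y',
  (mk x y <= mk x' y') = (x <= x') && (y <= y').
Hypothesis mk_surj : forall z, exists x y, z = mk x y.

Lemma mk_inj x y x' y' : mk x y = mk x' y' -> x = x' /\ y = y'.
Proof.
move=> E; have := lexx (mk x y); rewrite {1}E mk_le => /andP[x'x y'y].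
have := lexx (mk x y); rewrite {2}E mk_le => /andP[xx' yy'].
by split; apply/le_anti; rewrite ?xx' ?yy'.
Qed.

Lemma is_meet_mk x y x' y' x0 y0 :
  is_meet (mk x y) (mk x' y') (mk x0 y0) <-> is_meet x x' x0 /\ is_meet y y' y0.
Proof.
split=> [[]|[[x0x x0x' x0P] [y0y y0y' y0P]]].
  rewrite !mk_le => /andP[x0x y0y] /andP[x0x' y0y'] H.
  split; split=> // w wx wx'.
    by have := H (mk w y0); rewrite !mk_le wx wx' y0y y0y' lexx /= andbT; apply.
  by have := H (mk x0 w); rewrite !mk_le wx wx' x0x x0x' lexx /=; apply.
split; rewrite ?mk_le ?x0x ?x0x' // => w; have [a [b ->]] := mk_surj w.
by rewrite !mk_le => /andP[? ?] /andP[? ?]; rewrite x0P ?y0P.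
Qed.

Lemma is_join_mk x y x' y' x0 y0 :
  is_join (mk x y) (mk x' y') (mk x0 y0) <-> is_join x x' x0 /\ is_join y y' y0.
Proof.
split=> [[]|[[x0x x0x' x0P] [y0y y0y' y0P]]].
  rewrite !mk_le => /andP[x0x y0y] /andP[x0x' y0y'] H.
  split; split=> // w wx wx'.
    by have := H (mk w y0); rewrite !mk_le wx wx' y0y y0y' lexx /= andbT; apply.
  by have := H (mk x0 w); rewrite !mk_le wx wx' x0x x0x' lexx /=; apply.
split; rewrite ?mk_le ?x0x ?x0x' // => w; have [a [b ->]] := mk_surj w.
by rewrite !mk_le => /andP[? ?] /andP[? ?]; rewrite x0P ?y0P.
Qed.

Variables (a0 : P1) (b0 : P2).

(** The base points [a0] and [b0] embed each factor as a slice of [P], in which its meets and joins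
    are computed. *)
Lemma is_lattice_mk : is_lattice P <-> is_lattice P1 /\ is_lattice P2.
Proof.
split=> [H|[H1 H2] u v].
  split=> [x x'|y y'].
    have [[z Hz] [t Ht]] := H (mk x b0) (mk x' b0).
    have [z1 [z2 E]] := mk_surj z; have [t1 [t2 E']] := mk_surj t.
    move: Hz Ht; rewrite E E' is_meet_mk is_join_mk => -[Hz _] [Ht _].
    by split; [exists z1|exists t1].
  have [[z Hz] [t Ht]] := H (mk a0 y) (mk a0 y').
  have [z1 [z2 E]] := mk_surj z; have [t1 [t2 E']] := mk_surj t.
  move: Hz Ht; rewrite E E' is_meet_mk is_join_mk => -[_ Hz] [_ Ht].
  by split; [exists z2|exists t2].
have [x [y ->]] := mk_surj u; have [x' [y' ->]] := mk_surj v.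
have [[m1 M1] [j1 J1]] := H1 x x'; have [[m2 M2] [j2 J2]] := H2 y y'.
split; first by exists (mk m1 m2); rewrite is_meet_mk.
by exists (mk j1 j2); rewrite is_join_mk.
Qed.

Lemma is_boolean_lattice_mk :
  is_boolean_lattice P <-> is_boolean_lattice P1 /\ is_boolean_lattice P2.
Proof.
have /choice[pr Hpr] : forall z, exists p, z = mk p.1 p.2.
  by move=> z; have [x [y ->]] := mk_surj z; exists (x, y).
have prK x y : pr (mk x y) = (x, y).
  by have /mk_inj[] := Hpr (mk x y); case: (pr _) => ? ? /= -> ->.
split=> [[m [j [b [t [mjP btP dist compl]]]]]|].
  split.
  - exists (fun x x' => (pr (m (mk x b0) (mk x' b0))).1).
    exists (fun x x' => (pr (j (mk x b0) (mk x' b0))).1).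
    exists (pr b).1, (pr t).1.
    (* The second coordinates stay free: inner joins and complements computed in [P] are not known
       to have second coordinate [b0]. *)
    have mE x x' y y' : is_meet x x' (pr (m (mk x y) (mk x' y'))).1.
      have [+ _] := mjP (mk x y) (mk x' y').
      by rewrite [m _ _]Hpr prK /= is_meet_mk => -[].
    have jE x x' y y' : is_join x x' (pr (j (mk x y) (mk x' y'))).1.
      have [_ +] := mjP (mk x y) (mk x' y').
      by rewrite [j _ _]Hpr prK /= is_join_mk => -[].
    split=> [x x'|x|x y z|x].
    + by split; [exact: mE|exact: jE].
    + by have := btP (mk x b0); rewrite (Hpr b) (Hpr t) !prK !mk_le /=;
        move=> /andP[/andP[-> _] /andP[-> _]].
    + have E := congr1 pr (dist (mk x b0) (mk y b0) (mk z b0)).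
      have {}E := congr1 fst E.
      set u := (pr (j _ _)).1; set v := (pr (m (mk x b0) (mk y b0))).1.
      set w := (pr (m (mk x b0) (mk z b0))).1.
      (* The operations of the factor reset the second coordinate to [b0] after each use, unlike the
         terms of [E]; uniqueness of meets and joins bridges the difference. *)
      transitivity (pr (m (mk x b0) (j (mk y b0) (mk z b0)))).1.
        apply: is_meet_uniq (mE _ _ _ _) _.
        by rewrite [j _ _]Hpr -/u; exact: mE.
      rewrite E; apply: is_join_uniq (jE _ _ _ _).
      by rewrite [m _ _]Hpr -/v [m _ (mk z _)]Hpr -/w; exact: jE.
    + have [c [mc jc]] := compl (mk x b0); exists (pr c).1; split.
        rewrite -mc; apply: is_meet_uniq (mE _ _ _ _) _.
        by rewrite {2}(Hpr c); exact: mE.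
      rewrite -jc; apply: is_join_uniq (jE _ _ _ _) _.
      by rewrite {2}(Hpr c); exact: jE.
  - exists (fun x x' => (pr (m (mk a0 x) (mk a0 x'))).2).
    exists (fun x x' => (pr (j (mk a0 x) (mk a0 x'))).2).
    exists (pr b).2, (pr t).2.
    have mE x x' y y' : is_meet x x' (pr (m (mk y x) (mk y' x'))).2.
      have [+ _] := mjP (mk y x) (mk y' x').
      by rewrite [m _ _]Hpr prK /= is_meet_mk => -[].
    have jE x x' y y' : is_join x x' (pr (j (mk y x) (mk y' x'))).2.
      have [_ +] := mjP (mk y x) (mk y' x').
      by rewrite [j _ _]Hpr prK /= is_join_mk => -[].
    split=> [x x'|x|x y z|x].
    + by split; [exact: mE|exact: jE].
    + by have := btP (mk a0 x); rewrite (Hpr b) (Hpr t) !prK !mk_le /=;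
        move=> /andP[/andP[_ ->] /andP[_ ->]].
    + have E := congr1 pr (dist (mk a0 x) (mk a0 y) (mk a0 z)).
      have {}E := congr1 snd E.
      set u := (pr (j _ _)).2; set v := (pr (m (mk a0 x) (mk a0 y))).2.
      set w := (pr (m (mk a0 x) (mk a0 z))).2.
      transitivity (pr (m (mk a0 x) (j (mk a0 y) (mk a0 z)))).2.
        apply: is_meet_uniq (mE _ _ _ _) _.
        by rewrite [j _ _]Hpr -/u; exact: mE.
      rewrite E; apply: is_join_uniq (jE _ _ _ _).
      by rewrite [m _ _]Hpr -/v [m _ (mk _ z)]Hpr -/w; exact: jE.
    + have [c [mc jc]] := compl (mk a0 x); exists (pr c).2; split.
        rewrite -mc; apply: is_meet_uniq (mE _ _ _ _) _.
        by rewrite {2}(Hpr c); exact: mE.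
      rewrite -jc; apply: is_join_uniq (jE _ _ _ _) _.
      by rewrite {2}(Hpr c); exact: jE.
move=> [[m1 [j1 [b1 [t1 [mj1 bt1 dist1 compl1]]]]]].
move=> [m2 [j2 [b2 [t2 [mj2 bt2 dist2 compl2]]]]].
exists (fun u v => mk (m1 (pr u).1 (pr v).1) (m2 (pr u).2 (pr v).2)).
exists (fun u v => mk (j1 (pr u).1 (pr v).1) (j2 (pr u).2 (pr v).2)).
exists (mk b1 b2), (mk t1 t2); split=> [u v|u|u v w|u].
- have [x [y ->]] := mk_surj u; have [x' [y' ->]] := mk_surj v.
  rewrite !prK is_meet_mk is_join_mk /=.
  by have [] := mj1 x x'; have [] := mj2 y y'.
- by rewrite (Hpr u) !mk_le (andP (bt1 _)).1 (andP (bt1 _)).2 (andP (bt2 _)).1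
    (andP (bt2 _)).2.
- by rewrite !prK /= dist1 dist2.
- have [c1 [mc1 jc1]] := compl1 (pr u).1.
  have [c2 [mc2 jc2]] := compl2 (pr u).2.
  by exists (mk c1 c2); rewrite prK /= mc1 jc1 mc2 jc2.
Qed.

(** If x < x' and y < y', then [mk x y'] and [mk x' y] are incomparable. *)
Lemma linearly_ordered_mk : linearly_ordered P <->
  [/\ linearly_ordered P1, linearly_ordered P2
    & (forall x x' : P1, x = x') \/ (forall y y' : P2, y = y')].
Proof.
split=> [H|[H1 H2 H12] u v].
  have H1 : linearly_ordered P1.
    by move=> x x'; have := H (mk x b0) (mk x' b0); rewrite !mk_le lexx !andbT.
  have H2 : linearly_ordered P2.
    by move=> y y'; have := H (mk a0 y) (mk a0 y'); rewrite !mk_le lexx.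
  split=> //; apply: contrapT => /not_orP[].
  have lt_ex d' (Q : porderType d') : linearly_ordered Q ->
      ~ (forall x x' : Q, x = x') -> exists x x' : Q, x < x'.
    move=> HQ /existsNP[x /existsNP[x' xx']].
    case/orP: (HQ x x') => le_xx'; [exists x, x'|exists x', x].
      by rewrite lt_def le_xx' andbT eq_sym; apply/eqP.
    by rewrite lt_def le_xx' andbT; apply/eqP.
  move=> /(lt_ex _ _ H1)[x [x' xx']] /(lt_ex _ _ H2)[y [y' yy']].
  have := H (mk x y') (mk x' y).
  by rewrite !mk_le (lt_geF xx') (lt_geF yy') andbF.
have [x [y ->]] := mk_surj u; have [x' [y' ->]] := mk_surj v.
rewrite !mk_le; case: H12 => E; first by rewrite (E x x') lexx; exact: H2.
by rewrite (E y y') lexx !andbT; exact: H1.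
Qed.

End ProductOrder.

(** * Renaming and definable connectives *)

Lemma vcons0 (X : Type) n (x : X) (v : 'I_n -> X) : vcons x v ord0 = x.
Proof. by rewrite /vcons unlift_none. Qed.

Lemma vconsS (X : Type) n (x : X) (v : 'I_n -> X) i :
  vcons x v (lift ord0 i) = v i.
Proof. by rewrite /vcons liftK. Qed.

Lemma vcons_eta (X : Type) n (v : 'I_n.+1 -> X) :
  v = vcons (v ord0) (v \o lift ord0).
Proof.
apply/funext => i.
by case: (unliftP ord0 i) => [j|] ->; rewrite ?vcons0 ?vconsS.
Qed.

Lemma vcons_tail (X : Type) n (x : X) (v : 'I_n -> X) :
  vcons x v \o lift ord0 = v.
Proof. by apply/funext => i; rewrite /= vconsS. Qed.

Definition vnil (X : Type) (i : 'I_0) : X :=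
  match notF (ltn_ord i) with end.

Lemma ffun0_eq (X : Type) (v w : 'I_0 -> X) : v = w.
Proof. by apply/funext => -[]. Qed.

(** Recursion on [m] makes [m + n] reduce along with the tuple, so no cast between index types
    appears. *)
Fixpoint vcat (X : Type) m n : ('I_m -> X) -> ('I_n -> X) -> 'I_(m + n) -> X :=
  if m is m'.+1 then fun u v => vcons (u ord0) (vcat (u \o lift ord0) v)
  else fun _ v => v.

Lemma vcatl (X : Type) m n (u : 'I_m -> X) (v : 'I_n -> X) i :
  vcat u v (@lshift m n i) = u i.
Proof.
elim: m u i => [|m IH] u i; first by case: i.
case: (unliftP ord0 i) => [j|] -> /=.
  rewrite -[RHS](IH (u \o lift ord0)) -[RHS](vconsS (u ord0)).
  by congr vcons; exact: val_inj.
rewrite -[RHS](vcons0 (u ord0) (vcat (u \o lift ord0) v)).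
by congr vcons; exact: val_inj.
Qed.

Lemma vcatr (X : Type) m n (u : 'I_m -> X) (v : 'I_n -> X) i :
  vcat u v (rshift m i) = v i.
Proof.
elim: m u => [|m IH] u /=; first by congr v; exact: val_inj.
rewrite -[RHS](IH (u \o lift ord0)) -[RHS](vconsS (u ord0)).
by congr vcons; exact: val_inj.
Qed.

Lemma vcat_lshift (X : Type) m n (u : 'I_m -> X) (v : 'I_n -> X) :
  vcat u v \o @lshift m n = u.
Proof. by apply/funext => i; exact: vcatl. Qed.

Lemma vcat_rshift (X : Type) m n (u : 'I_m -> X) (v : 'I_n -> X) :
  vcat u v \o @rshift m n = v.
Proof. by apply/funext => i; exact: vcatr. Qed.

Section Formulas.
Variable L : language.

Fixpoint rename_term n m (s : 'I_n -> 'I_m) (t : term L n) : term L m :=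
  match t with
  | TVar i => TVar L (s i)
  | TFun f ts => TFun (fun i => rename_term s (ts i))
  end.

Definition lift_ren n m (s : 'I_n -> 'I_m) : 'I_n.+1 -> 'I_m.+1 :=
  vcons ord0 (lift ord0 \o s).

Fixpoint rename n (phi : formula L n) :
    forall m, ('I_n -> 'I_m) -> formula L m :=
  match phi with
  | FBot _ => fun m _ => FBot L m
  | FEq _ t u => fun m s => FEq (rename_term s t) (rename_term s u)
  | FRel _ r ts => fun m s => FRel (fun i => rename_term s (ts i))
  | FImp _ p q => fun m s => FImp (rename p s) (rename q s)
  | FAll _ p => fun m s => FAll (rename p (lift_ren s))
  end.

Lemma eval_rename (M : structure L) n m (s : 'I_n -> 'I_m) (w : 'I_m -> M) t :
  eval M w (rename_term s t) = eval M (w \o s) t.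
Proof.
by elim: t => [//|f ts IH] /=; congr (fun_int M f _); apply/funext.
Qed.

Lemma vcons_lift_ren (X : Type) n m (s : 'I_n -> 'I_m) (x : X) (w : 'I_m -> X) :
  vcons x w \o lift_ren s = vcons x (w \o s).
Proof. by rewrite /lift_ren comp_vcons vcons0 compA vcons_tail. Qed.

Lemma sat_rename (M : structure L) n (phi : formula L n) m (s : 'I_n -> 'I_m)
    (w : 'I_m -> M) : sat M (rename phi s) w <-> sat M phi (w \o s).
Proof.
elim: n / phi m s w => /= [n|n t u|n r ts|n p IHp q IHq|n p IH] m s w.
- by [].
- by rewrite !eval_rename.
- suff -> : (fun i => eval M w (rename_term s (ts i))) =
    (fun i => eval M (w \o s) (ts i)) by [].
  by apply/funext => i; rewrite eval_rename.
- by rewrite IHp IHq.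
- by split=> H x; move: (H x); rewrite IH vcons_lift_ren.
Qed.

Definition FTop n : formula L n := FNot (FBot L n).
Definition FAnd n (p q : formula L n) := FNot (FImp p (FNot q)).
Definition FOr n (p q : formula L n) := FImp (FNot p) q.
Definition FEx n (p : formula L n.+1) := FNot (FAll (FNot p)).

Fixpoint FAnds n m : ('I_m -> formula L n) -> formula L n :=
  if m is m'.+1 then fun p => FAnd (p ord0) (FAnds (p \o lift ord0))
  else fun=> FTop n.

Fixpoint FExs m n : formula L (m + n) -> formula L n :=
  if m is m'.+1 then fun p => FExs (FEx p : formula L (m' + n)) else id.

Fixpoint FAlls n : formula L n -> sentence L :=
  if n is n'.+1 then fun p => FAlls (FAll p) else id.

Section Sat.
Variable M : structure L.

Lemma sat_imp n (p q : formula L n) v :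
  sat M (FImp p q) v <-> (sat M p v -> sat M q v).
Proof. by []. Qed.

Lemma sat_all n (p : formula L n.+1) v :
  sat M (FAll p) v <-> forall x, sat M p (vcons x v).
Proof. by []. Qed.

Lemma sat_not n (p : formula L n) v : sat M (FNot p) v <-> ~ sat M p v.
Proof. by []. Qed.

Lemma sat_top n v : sat M (FTop n) v.
Proof. by move=> []. Qed.

Lemma sat_and n (p q : formula L n) v :
  sat M (FAnd p q) v <-> sat M p v /\ sat M q v.
Proof.
split=> /= [H|[Hp Hq] H]; last exact: H.
by split; apply: contrapT => Hn; apply: H.
Qed.

Lemma sat_or n (p q : formula L n) v :
  sat M (FOr p q) v <-> sat M p v \/ sat M q v.
Proof.
split=> /= [H|[Hp|Hq] //].
by case: (pselect (sat M p v)) => Hp; [left|right; apply: H].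
Qed.

Lemma sat_ex n (p : formula L n.+1) v :
  sat M (FEx p) v <-> exists x, sat M p (vcons x v).
Proof.
split=> /= [H|[x Hx] H]; last exact: (H x).
by apply: contrapT => Hn; apply: H => x Hx; apply: Hn; exists x.
Qed.

Lemma sat_ands n m (p : 'I_m -> formula L n) v :
  sat M (FAnds p) v <-> forall i, sat M (p i) v.
Proof.
elim: m p => [|m IH] p; first by split=> [_ [] | _] //=.
rewrite sat_and IH; split=> [[H0 H] i|H]; last by split=> // i; exact: H.
by case: (unliftP ord0 i) => [j|] ->; [exact: H|].
Qed.

Lemma sat_exs m n (p : formula L (m + n)) v :
  sat M (FExs p) v <-> exists u : 'I_m -> M, sat M p (vcat u v).
Proof.
elim: m p => [|m IH] p /=.
  by split=> [H|[]//]; exists (@vnil M).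
rewrite IH; split=> [[u] /sat_ex[x H]|[u H]]; last first.
  by exists (u \o lift ord0); apply/sat_ex; exists (u ord0).
by exists (vcons x u); rewrite /= vcons0 vcons_tail.
Qed.

Lemma holds_alls n (p : formula L n) :
  holds M (FAlls p) <-> forall v, sat M p v.
Proof.
elim: n p => [|n IH] p //=; rewrite IH.
by split=> [H v|H v x]; [rewrite (vcons_eta v); exact: H|exact: H].
Qed.

End Sat.

(** Passes an isolating formula from a long tuple to a subtuple. As [s] may repeat or omit indices,
    the subtuple is tied to the long one by explicit equations. *)
Definition FProj n m (s : 'I_n -> 'I_m) (p : formula L m) : formula L n :=
  FExs (FAnd (rename p (@lshift m n))
    (FAnds (fun i => FEq (TVar L (@lshift m n (s i))) (TVar L (rshift m i))))).

Lemma sat_proj (M : structure L) n m (s : 'I_n -> 'I_m) (p : formula L m) v :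
  sat M (FProj s p) v <-> exists2 w, sat M p w & w \o s = v.
Proof.
rewrite sat_exs; split=> [[w]|[w H <-]].
  rewrite sat_and sat_rename vcat_lshift sat_ands => -[H E]; exists w => //.
  by apply/funext => i; have := E i; rewrite /= vcatl vcatr.
exists w; rewrite sat_and sat_rename vcat_lshift; split=> //.
by rewrite sat_ands => i /=; rewrite vcatl vcatr.
Qed.

End Formulas.

(** * Relativization to a definable part *)

Section Interpretation.
Variables (L K : language).
Variables (pP : formula K 1) (pR : forall r : rel_sym L, formula K (rel_ar r)).
Variable (pG : forall f : fun_sym L, formula K (fun_ar f).+1).

Definition in_part (N : structure K) (x : N) : Prop := sat N pP (fun=> x).

(** The last two fields confine relations and graphs to the part. They let [du_structure_iso]
    reflect a relation of [N] whose arguments are not known in advance to come from [M]. *)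
Record interprets (M : structure L) (N : structure K) (h : M -> N) : Prop := {
  interp_inj : injective h;
  interp_part : forall x, in_part x <-> exists a, x = h a;
  interp_rel : forall r v, sat N (pR r) (h \o v) <-> rel_int M r v;
  interp_graph : forall f v x,
    sat N (pG f) (vcons x (h \o v)) <-> x = h (fun_int M f v);
  interp_rel_part : forall r v, sat N (pR r) v -> forall i, in_part (v i);
  interp_graph_part : forall f v, sat N (pG f) v -> forall i, in_part (v i) }.

(* The formula saying that variable 0 is the value of t. *)
Fixpoint tr_term n (t : term L n) : formula K n.+1 :=
  match t with
  | TVar i => FEq (TVar K ord0) (TVar K (lift ord0 i))
  | @TFun _ _ f ts => @FExs K (fun_ar f) n.+1 (FAnd
      (FAnds (fun i => rename (tr_term (ts i))
         (vcons (@lshift _ n.+1 i) (@rshift _ n.+1 \o lift ord0))))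
      (rename (pG f) (vcons (@rshift _ n.+1 ord0) (@lshift _ n.+1))))
  end.

(** Only the universal quantifier is relativized. The quantifiers introduced for values of terms
    range over all of [N], and [sat_tr_term] forces these values into the image of [h]. *)
Fixpoint tr n (phi : formula L n) : formula K n :=
  match phi in formula _ n return formula K n with
  | FBot n => FBot K n
  | FEq _ s t => FEx (FAnd (tr_term s) (tr_term t))
  | @FRel _ n r ts => @FExs K (rel_ar r) n (FAnd
      (FAnds (fun i => rename (tr_term (ts i))
         (vcons (@lshift _ n i) (@rshift _ n))))
      (rename (pR r) (@lshift _ n)))
  | FImp _ p q => FImp (tr p) (tr q)
  | FAll n p => FAll (FImp (rename pP (fun=> ord0)) (tr p))
  end.

Lemma sat_part_rename (N : structure K) n (i : 'I_n) (v : 'I_n -> N) :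
  sat N (rename pP (fun=> i)) v <-> in_part (v i).
Proof. exact: sat_rename. Qed.

Section Translation.
Variables (M : structure L) (N : structure K) (h : M -> N).
Hypothesis hP : interprets h.

Lemma sat_tr_term n (t : term L n) (v : 'I_n -> M) x :
  sat N (tr_term t) (vcons x (h \o v)) <-> x = h (eval M v t).
Proof.
elim: t x => [i|f ts IH] x; first by rewrite /= vcons0 vconsS.
have E y u i : sat N (rename (tr_term (ts i))
    (vcons (@lshift _ n.+1 i) (@rshift _ n.+1 \o lift ord0)))
    (vcat u (vcons y (h \o v))) <-> u i = h (eval M v (ts i)).
  by rewrite sat_rename comp_vcons vcatl compA vcat_rshift vcons_tail IH.
rewrite [tr_term _]/= sat_exs; split=> [[u]|->].
  rewrite sat_and sat_rename comp_vcons vcatr vcons0 vcat_lshift sat_ands.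
  move=> [Hu]; have -> : u = h \o (fun i => eval M v (ts i)).
    by apply/funext => i; apply/(E x); exact: Hu.
  by move/(interp_graph hP).
exists (h \o (fun i => eval M v (ts i))).
rewrite sat_and sat_rename comp_vcons vcatr vcons0 vcat_lshift sat_ands.
by split; [move=> i; exact/E|apply/(interp_graph hP)].
Qed.

Lemma sat_tr n (phi : formula L n) (v : 'I_n -> M) :
  sat N (tr phi) (h \o v) <-> sat M phi v.
Proof.
elim: n / phi v => [n|n s t|n r ts|n p IHp q IHq|n p IH] v.
- by [].
- rewrite [tr _]/= sat_ex; split=> [[x]|E].
    by rewrite sat_and !sat_tr_term => -[->]; exact: interp_inj.
  have {}E : eval M v s = eval M v t by [].
  by exists (h (eval M v s)); rewrite sat_and !sat_tr_term E.
- have E u i : sat N (rename (tr_term (ts i))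
      (vcons (@lshift _ n i) (@rshift _ n))) (vcat u (h \o v)) <->
      u i = h (eval M v (ts i)).
    by rewrite sat_rename comp_vcons vcatl vcat_rshift sat_tr_term.
  rewrite [tr _]/= sat_exs; split=> [[u]|H].
    rewrite sat_and sat_rename vcat_lshift sat_ands => -[Hu].
    have -> : u = h \o (fun i => eval M v (ts i)).
      by apply/funext => i; apply/E; exact: Hu.
    by move/(interp_rel hP).
  exists (h \o (fun i => eval M v (ts i))).
  rewrite sat_and sat_rename vcat_lshift sat_ands.
  by split; [move=> i; exact/E|apply/(interp_rel hP)].
- by rewrite /= IHp IHq.
- split=> /= H x.
    apply/IH; rewrite comp_vcons; apply: H.
    by rewrite sat_part_rename vcons0; apply/(interp_part hP); exists x.
  rewrite sat_part_rename vcons0 => /(interp_part hP)[a ->].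
  by rewrite -comp_vcons; apply/IH.
Qed.

Lemma tr_models (T : theory L) :
  models M T <-> forall phi, T phi -> holds N (tr phi).
Proof.
split=> H phi /H Hphi v.
  by rewrite (ffun0_eq v (h \o @vnil M)); apply/sat_tr; exact: Hphi.
by apply/sat_tr; exact: Hphi.
Qed.

End Translation.

Lemma interprets_exists (N : structure K) :
  (exists x : N, in_part x) ->
  (forall r v, sat N (pR r) v -> forall i, in_part (v i)) ->
  (forall f v, sat N (pG f) v -> forall i, in_part (v i)) ->
  (forall f v, (forall i, in_part (v i)) ->
     exists x, sat N (pG f) (vcons x v)) ->
  (forall f v x y, sat N (pG f) (vcons x v) -> sat N (pG f) (vcons y v) ->
     x = y) ->
  exists (M : structure L) (h : M -> N), interprets h.
Proof.
move=> [x0 Px0] relP graphP graph_tot graph_fun.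
pose X := {x : N | in_part x}.
have /choice[F HF] : forall p : {f : fun_sym L & 'I_(fun_ar f) -> X},
    exists x : X,
      sat N (pG (projT1 p)) (vcons (sval x) (fun i => sval (projT2 p i))).
  move=> [f v] /=; case: (graph_tot f (fun i => sval (v i))) => [i|x Hx].
    exact: (svalP (v i)).
  have Px : in_part x by have := graphP _ _ Hx ord0; rewrite vcons0.
  by exists (exist _ x Px).
pose M := @Structure L X (inhabits (exist _ x0 Px0))
  (fun f v => F (existT _ f v)) (fun r v => sat N (pR r) (fun i => sval (v i))).
exists M, (fun x : X => sval x); split=> //.
- by move=> [x Px] [y Py] /= E; exact: eq_exist.
- move=> x; split=> [Px|[a ->]]; first by exists (exist _ x Px).
  exact: svalP.
- move=> f v x; have H := HF (existT _ f v); split=> [Hx|->] //.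
  exact: graph_fun Hx H.
Qed.

(** Each condition of [interprets_exists] and each translated axiom of [T] is a formula valid
    throughout [C], hence valid in [N]. The class [C] will be that of disjoint unions of models. *)
Lemma interprets_transfer (C : structure K -> Prop) (T : theory L)
    (N : structure K) :
  (forall N', C N' -> exists2 M : structure L, models M T &
     exists h : M -> N', interprets h) ->
  (forall n (phi : formula K n),
     (forall N', C N' -> forall v : 'I_n -> N', sat N' phi v) ->
     forall v : 'I_n -> N, sat N phi v) ->
  exists2 M : structure L, models M T & exists h : M -> N, interprets h.
Proof.
move=> CT CN.
have inP (N' : structure K) n (v : 'I_n -> N') :
    sat N' (FAnds (fun i => rename pP (fun=> i))) v <-> forall i, in_part (v i).
  by rewrite sat_ands; split=> H i; apply/sat_part_rename; exact: H.
have := @interprets_exists N; case.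
- have E (N' : structure K) x (v : 'I_0 -> N') : vcons x v = (fun=> x : N').
    by apply/funext => i; rewrite ord1 vcons0.
  suff /sat_ex[x Hx] : sat N (FEx pP) (@vnil N).
    by exists x; rewrite /in_part -(E _ _ (@vnil N)).
  apply: CN => N' /CT[M _ [h hP]] v; apply/sat_ex.
  case: (carrier_inhabited M) => a; exists (h a).
  by rewrite E; apply/(interp_part hP); exists a.
- move=> r v Hr; apply/inP; move: Hr.
  apply: (CN _ (FImp (pR r) (FAnds (fun i => rename pP (fun=> i))))).
  move=> N' /CT[M _ [h hP]] w; apply/sat_imp => Hw.
  by apply/inP; exact: (interp_rel_part hP Hw).
- move=> f v Hf; apply/inP; move: Hf.
  apply: (CN _ (FImp (pG f) (FAnds (fun i => rename pP (fun=> i))))).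
  move=> N' /CT[M _ [h hP]] w; apply/sat_imp => Hw.
  by apply/inP; exact: (interp_graph_part hP Hw).
- move=> f v /inP Hv; apply/sat_ex; move: Hv.
  apply: (CN _ (FImp (FAnds (fun i => rename pP (fun=> i))) (FEx (pG f)))).
  move=> N' /CT[M _ [h hP]] w; apply/sat_imp => Hw; apply/sat_ex.
  have /choice[u Hu] : forall i, exists a, w i = h a.
    by move=> i; apply/(interp_part hP); move/inP: Hw.
  exists (h (fun_int M f u)); have -> : w = h \o u by apply/funext.
  by apply/(interp_graph hP).
- move=> f v x y Hx Hy.
  (* The renaming [s i] keeps the arguments of the graph and takes variable [i], one of the two
     candidate values, as the value. *)
  pose s i : 'I_(fun_ar f).+1 -> 'I_(fun_ar f).+2 :=
    vcons i (lift ord0 \o lift ord0).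
  have Es (N' : structure K) (a b : N') w i : vcons a (vcons b w) \o s i =
      vcons (vcons a (vcons b w) i) w.
    by rewrite /s comp_vcons compA vcons_tail vcons_tail.
  have := CN _ (FImp (rename (pG f) (s ord0)) (FImp
    (rename (pG f) (s (lift ord0 ord0)))
    (FEq (TVar K ord0) (TVar K (lift ord0 ord0))))) _ (vcons x (vcons y v)).
  rewrite /= !sat_rename !Es vcons0 vconsS vcons0; apply=> //.
  move=> N' /CT[M _ [h hP]] w; rewrite (vcons_eta w).
  rewrite (vcons_eta (_ \o lift ord0)) /=.
  rewrite !sat_rename !Es vcons0 vconsS vcons0.
  set a := w _; set b := w _; set c := _ \o _ => Ha Hb.
  have /choice[u Hu] : forall i, exists a, c i = h a.
    move=> i; apply/(interp_part hP).
    by have := interp_graph_part hP Ha (lift ord0 i); rewrite vconsS.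
  have Ec : c = h \o u by apply/funext.
  by move: Ha Hb; rewrite Ec => /(interp_graph hP)-> /(interp_graph hP)->.
- move=> M [h hP]; exists M; last by exists h.
  apply/(tr_models hP) => phi Tphi; apply: CN => N' /CT[M' TM' [h' hP']] v.
  exact: (proj1 (tr_models hP' T) TM').
Qed.

End Interpretation.

(** * Models of the disjoint union *)

Definition atom (L : language) (r : rel_sym L) : formula L (rel_ar r) :=
  FRel (fun i => TVar L i).

Section DisjointUnion.
Variables (L1 L2 : language).
Local Notation L := (du_language L1 L2).

Definition duP1 : formula L 1 := @atom L (DPart1 L1 L2).
Definition duP2 : formula L 1 := @atom L (DPart2 L1 L2).
Definition duR1 (r : rel_sym L1) : formula L (rel_ar r) :=
  @atom L (DRel1 L2 r).
Definition duR2 (r : rel_sym L2) : formula L (rel_ar r) :=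
  @atom L (DRel2 L1 r).
Definition duG1 (f : fun_sym L1) : formula L (fun_ar f).+1 :=
  @atom L (DGraph1 L2 f).
Definition duG2 (f : fun_sym L2) : formula L (fun_ar f).+1 :=
  @atom L (DGraph2 L1 f).

Lemma inl_inj (A B : Type) : injective (@inl A B).
Proof. by move=> a b []. Qed.

Lemma inr_inj (A B : Type) : injective (@inr A B).
Proof. by move=> a b []. Qed.

Lemma comp_injI (A B C : Type) (f : B -> C) (u v : A -> B) :
  injective f -> f \o u = f \o v -> u = v.
Proof.
by move=> fI E; apply/funext => i; apply: fI; exact: (congr1 (@^~ i) E).
Qed.

Lemma vcons_inj (X : Type) n (x y : X) (v w : 'I_n -> X) :
  vcons x v = vcons y w -> x = y /\ v = w.
Proof.
move=> E; split; first by rewrite -(vcons0 x v) E vcons0.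
by rewrite -(vcons_tail x v) E vcons_tail.
Qed.

Section Structures.
Variables (M1 : structure L1) (M2 : structure L2).
Local Notation M := (du_structure M1 M2).

Lemma du_interprets1 : @interprets L1 L duP1 duR1 duG1 M1 M inl.
Proof.
split=> /=.
- exact: inl_inj.
- by [].
- move=> r v; split=> [[y E ?]|Hv]; last by exists v.
  by rewrite (comp_injI (@inl_inj _ _) E).
- move=> f v x; split=> [[y]|->]; last by exists v; rewrite comp_vcons.
  change (vcons x (inl \o v) = inl \o vcons (fun_int _ f y) y ->
    x = inl (fun_int _ f v)).
  rewrite comp_vcons => E0; have [-> E] := vcons_inj E0.
  by rewrite (comp_injI (@inl_inj _ _) E).
- by move=> r v [y E _] i; exists (y i); exact: (congr1 (@^~ i) E).
- by move=> f v [y E] i; eexists; exact: (congr1 (@^~ i) E).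
Qed.

Lemma du_interprets2 : @interprets L2 L duP2 duR2 duG2 M2 M inr.
Proof.
split=> /=.
- exact: inr_inj.
- by [].
- move=> r v; split=> [[y E ?]|Hv]; last by exists v.
  by rewrite (comp_injI (@inr_inj _ _) E).
- move=> f v x; split=> [[y]|->]; last by exists v; rewrite comp_vcons.
  change (vcons x (inr \o v) = inr \o vcons (fun_int _ f y) y ->
    x = inr (fun_int _ f v)).
  rewrite comp_vcons => E0; have [-> E] := vcons_inj E0.
  by rewrite (comp_injI (@inr_inj _ _) E).
- by move=> r v [y E _] i; exists (y i); exact: (congr1 (@^~ i) E).
- by move=> f v [y E] i; eexists; exact: (congr1 (@^~ i) E).
Qed.

End Structures.

Lemma interprets_lift (La K : language) pP pR pG (M : structure La)
    (N : structure K) (h : M -> N) n (v : 'I_n -> N) :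
  @interprets La K pP pR pG M N h -> (forall i, in_part pP (v i)) ->
  exists u, v = h \o u.
Proof.
move=> hP /(_ _)/(interp_part hP) Hv.
have /choice[u Hu] : forall i, exists a, v i = h a by exact: Hv.
by exists u; apply/funext.
Qed.

Lemma du_structure_iso (N : structure L) (M1 : structure L1)
    (M2 : structure L2) (h1 : M1 -> N) (h2 : M2 -> N) :
  interprets duP1 duR1 duG1 h1 -> interprets duP2 duR2 duG2 h2 ->
  (forall x : N, in_part duP1 x \/ in_part duP2 x) ->
  (forall x : N, in_part duP1 x -> ~ in_part duP2 x) ->
  isomorphic (du_structure M1 M2) N.
Proof.
move=> h1P h2P parts disj.
pose f (x : M1 + M2) := match x with inl a => h1 a | inr b => h2 b end.
have P1 a : in_part duP1 (h1 a) by apply/(interp_part h1P); exists a.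
have P2 b : in_part duP2 (h2 b) by apply/(interp_part h2P); exists b.
have fI : injective f.
  move=> [a|a] [b|b] /= E.
  - by rewrite (interp_inj h1P E).
  - by case: (disj _ (P1 a)); rewrite E.
  - by case: (disj _ (P1 b)); rewrite -E.
  - by rewrite (interp_inj h2P E).
exists f; split.
- rewrite -setTT_bijective; split=> [//|x y _ _|x _]; first exact: fI.
  case: (parts x) => [/(interp_part h1P)|/(interp_part h2P)] [a ->].
    by exists (inl a).
  by exists (inr a).
- by case.
- case=> [||r|r|g|g] x.
  + rewrite -[rel_int N _ _]/(sat N duP1 (f \o x)).
    have -> : f \o x = (fun=> f (x ord0)) by apply/funext => i; rewrite ord1.
    split=> [[a /= ->]|]; first exact: P1.
    case E: (x ord0) => [a|b] H; first by exists a.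
    by case: (disj _ H (P2 b)).
  + rewrite -[rel_int N _ _]/(sat N duP2 (f \o x)).
    have -> : f \o x = (fun=> f (x ord0)) by apply/funext => i; rewrite ord1.
    split=> [[a /= ->]|]; first exact: P2.
    case E: (x ord0) => [a|b] H; last by exists b.
    by case: (disj _ (P1 a) H).
  + rewrite -[rel_int N _ _]/(sat N (duR1 r) (f \o x)).
    split=> [[y -> ?]|H]; first by apply/(interp_rel h1P).
    have [u Hu] := interprets_lift h1P (interp_rel_part h1P H).
    exists u; last by apply/(interp_rel h1P); rewrite -Hu.
    by apply: (comp_injI fI); rewrite Hu.
  + rewrite -[rel_int N _ _]/(sat N (duR2 r) (f \o x)).
    split=> [[y -> ?]|H]; first by apply/(interp_rel h2P).
    have [u Hu] := interprets_lift h2P (interp_rel_part h2P H).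
    exists u; last by apply/(interp_rel h2P); rewrite -Hu.
    by apply: (comp_injI fI); rewrite Hu.
  + rewrite -[rel_int N _ _]/(sat N (duG1 g) (f \o x)).
    split=> [[y ->]|H].
      by rewrite compA comp_vcons; apply/(interp_graph h1P).
    have [u Hu] := interprets_lift h1P (interp_graph_part h1P H).
    exists (u \o lift ord0); apply: (comp_injI fI); rewrite compA Hu.
    rewrite -[RHS]/(h1 \o _); suff <- : u ord0 = fun_int M1 g (u \o lift ord0).
      by rewrite -vcons_eta.
    apply: (interp_inj h1P); apply/(interp_graph h1P).
    by rewrite -comp_vcons -vcons_eta -Hu.
  + rewrite -[rel_int N _ _]/(sat N (duG2 g) (f \o x)).
    split=> [[y ->]|H].
      by rewrite compA comp_vcons; apply/(interp_graph h2P).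
    have [u Hu] := interprets_lift h2P (interp_graph_part h2P H).
    exists (u \o lift ord0); apply: (comp_injI fI); rewrite compA Hu.
    rewrite -[RHS]/(h2 \o _); suff <- : u ord0 = fun_int M2 g (u \o lift ord0).
      by rewrite -vcons_eta.
    apply: (interp_inj h2P); apply/(interp_graph h2P).
    by rewrite -comp_vcons -vcons_eta -Hu.
Qed.

Lemma du_model_valid (T1 : theory L1) (T2 : theory L2) (N : structure L) :
  models N (du_theory T1 T2) -> forall n (phi : formula L n),
  (forall (M1 : structure L1) (M2 : structure L2),
     models M1 T1 -> models M2 T2 ->
     forall v : 'I_n -> du_structure M1 M2, sat _ phi v) ->
  forall v : 'I_n -> N, sat N phi v.
Proof.
move=> NT n phi H; apply/holds_alls; apply: NT => M1 M2 M1T M2T.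
by apply/holds_alls; exact: H.
Qed.

Lemma du_model_iso (T1 : theory L1) (T2 : theory L2) (N : structure L) :
  models N (du_theory T1 T2) -> exists (M1 : structure L1) (M2 : structure L2),
    [/\ models M1 T1, models M2 T2 & isomorphic (du_structure M1 M2) N].
Proof.
move=> /du_model_valid NT.
pose C N' := exists (M1 : structure L1) (M2 : structure L2),
  [/\ models M1 T1, models M2 T2 & N' = du_structure M1 M2].
have CN n (phi : formula L n) :
    (forall N', C N' -> forall v : 'I_n -> N', sat N' phi v) ->
    forall v : 'I_n -> N, sat N phi v.
  by move=> H; apply: NT => M1 M2 M1T M2T; apply: H; exists M1, M2.
have [|M1 M1T [h1 h1P]] := @interprets_transfer _ _ duP1 duR1 duG1 C T1 N _ CN.
  move=> _ [M1 [M2 [M1T _ ->]]]; exists M1 => //; exists inl.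
  exact: du_interprets1.
have [|M2 M2T [h2 h2P]] := @interprets_transfer _ _ duP2 duR2 duG2 C T2 N _ CN.
  move=> _ [M1' [M2 [_ M2T ->]]]; exists M2 => //; exists inr.
  exact: du_interprets2.
exists M1, M2; split=> //; apply: (du_structure_iso h1P h2P).
- move=> x; apply/(sat_or duP1 duP2); move: (fun=> x); apply: CN.
  move=> _ [M1' [M2' [_ _ ->]]] v; apply/sat_or => /=.
  by case: (v ord0) => a; [left|right]; exists a.
- move=> x; apply: (CN 1%N (FImp duP1 (FNot duP2)) _ (fun=> x)).
  by move=> _ [M1' [M2' [_ _ ->]]] v /= [a ->] [b].
Qed.

Lemma models_du (T1 : theory L1) (T2 : theory L2) M1 M2 :
  models M1 T1 -> models M2 T2 -> models (du_structure M1 M2) (du_theory T1 T2).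
Proof. by move=> M1T M2T phi; exact. Qed.

End DisjointUnion.

(** * The Feferman-Vaught decomposition *)

Section FefermanVaught.
Variables (L1 L2 : language).
Local Notation L := (du_language L1 L2).

(** A valuation in a disjoint union is recorded as one valuation in each part and a pattern [s]
    giving the part and index of every variable. The decomposition of a formula depends on the
    pattern; [splitl] and [splitr] extend it by a new variable 0 in either part. *)
Definition merge (X1 X2 : Type) n1 n2 (v1 : 'I_n1 -> X1) (v2 : 'I_n2 -> X2)
    (x : 'I_n1 + 'I_n2) : X1 + X2 :=
  match x with inl i => inl (v1 i) | inr i => inr (v2 i) end.

Definition splitl n n1 n2 (s : 'I_n -> 'I_n1 + 'I_n2) :
    'I_n.+1 -> 'I_n1.+1 + 'I_n2 :=
  vcons (inl ord0) (fun i => match s i with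
    inl j => inl (lift ord0 j) | inr j => inr j end).

Definition splitr n n1 n2 (s : 'I_n -> 'I_n1 + 'I_n2) :
    'I_n.+1 -> 'I_n1 + 'I_n2.+1 :=
  vcons (inr ord0) (fun i => match s i with
    inl j => inl j | inr j => inr (lift ord0 j) end).

Lemma merge_splitl (X1 X2 : Type) n n1 n2 (s : 'I_n -> 'I_n1 + 'I_n2) x
    (v1 : 'I_n1 -> X1) (v2 : 'I_n2 -> X2) :
  merge (vcons x v1) v2 \o splitl s = vcons (inl x) (merge v1 v2 \o s).
Proof.
rewrite /splitl comp_vcons /= vcons0; congr vcons; apply/funext => i /=.
by case: (s i) => j //=; rewrite vconsS.
Qed.

Lemma merge_splitr (X1 X2 : Type) n n1 n2 (s : 'I_n -> 'I_n1 + 'I_n2) x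
    (v1 : 'I_n1 -> X1) (v2 : 'I_n2 -> X2) :
  merge v1 (vcons x v2) \o splitr s = vcons (inr x) (merge v1 v2 \o s).
Proof.
rewrite /splitr comp_vcons /= vcons0; congr vcons; apply/funext => i /=.
by case: (s i) => j //=; rewrite vconsS.
Qed.

Lemma merge_inl (X1 X2 : Type) n n1 n2 (s : 'I_n -> 'I_n1 + 'I_n2)
    (v1 : 'I_n1 -> X1) (v2 : 'I_n2 -> X2) u :
  merge v1 v2 \o s = inl \o u -> exists b, s = inl \o b.
Proof.
move=> E; have /choice[b Hb] : forall i, exists j, s i = inl j.
  move=> i; move: (congr1 (@^~ i) E) => /=.
  by case: (s i) => //= j _; exists j.
by exists b; apply/funext.
Qed.

Lemma merge_inr (X1 X2 : Type) n n1 n2 (s : 'I_n -> 'I_n1 + 'I_n2)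
    (v1 : 'I_n1 -> X1) (v2 : 'I_n2 -> X2) u :
  merge v1 v2 \o s = inr \o u -> exists b, s = inr \o b.
Proof.
move=> E; have /choice[b Hb] : forall i, exists j, s i = inr j.
  move=> i; move: (congr1 (@^~ i) E) => /=.
  by case: (s i) => //= j _; exists j.
by exists b; apply/funext.
Qed.

(** The last two conditions keep [v1] and [v2] among the entries of [v], so that they stay in the
    domain of a partial elementary map. *)
Lemma split_valuation (X1 X2 : Type) n (v : 'I_n -> X1 + X2) :
  exists n1 n2 (v1 : 'I_n1 -> X1) (v2 : 'I_n2 -> X2) s,
    [/\ v = merge v1 v2 \o s, forall i, exists j, v j = inl (v1 i)
      & forall i, exists j, v j = inr (v2 i)].
Proof.
elim: n v => [|n IH] v.
  exists 0%N, 0%N, (@vnil X1), (@vnil X2), (@vnil _).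
  by split=> [|[]|[]] //; exact: ffun0_eq.
have [n1 [n2 [v1 [v2 [s [E H1 H2]]]]]] := IH (v \o lift ord0).
rewrite (vcons_eta v) E; case: (v ord0) => x.
- exists n1.+1, n2, (vcons x v1), v2, (splitl s); rewrite merge_splitl -E.
  split=> // i; last first.
    by have [j Hj] := H2 i; exists (lift ord0 j); rewrite vconsS.
  case: (unliftP ord0 i) => [j|] ->; last by exists ord0; rewrite !vcons0.
  by rewrite vconsS; have [k Hk] := H1 j; exists (lift ord0 k); rewrite vconsS.
- exists n1, n2.+1, v1, (vcons x v2), (splitr s); rewrite merge_splitr -E.
  split=> // i.
    by have [j Hj] := H1 i; exists (lift ord0 j); rewrite vconsS.
  case: (unliftP ord0 i) => [j|] ->; last by exists ord0; rewrite !vcons0.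
  by rewrite vconsS; have [k Hk] := H2 j; exists (lift ord0 k); rewrite vconsS.
Qed.

Section Dnf.
Variables n1 n2 : nat.
Implicit Types l : seq (formula L1 n1 * formula L2 n2).

(** A finite union of rectangles. The form survives negation, and also quantification over one part,
    since an existential quantifier commutes with the union and acts on one side of each
    rectangle. *)
Fixpoint dnf l (M1 : structure L1) (M2 : structure L2)
    (v1 : 'I_n1 -> M1) (v2 : 'I_n2 -> M2) : Prop :=
  if l is p :: l' then (sat M1 p.1 v1 /\ sat M2 p.2 v2) \/ dnf l' v1 v2
  else False.

Definition dnf_top : seq (formula L1 n1 * formula L2 n2) :=
  [:: (FTop L1 n1, FTop L2 n2)].

Definition dnf_conj p q l := [seq (FAnd p r.1, FAnd q r.2) | r <- l].

(** The complement of a rectangle is the union of two rectangles, one for failure on each side;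
    these are distributed over the complement of the rest. *)
Fixpoint dnf_not l :=
  if l is p :: l' then dnf_conj (FNot p.1) (FTop L2 n2) (dnf_not l') ++
    dnf_conj (FTop L1 n1) (FNot p.2) (dnf_not l')
  else dnf_top.

Variables (M1 : structure L1) (M2 : structure L2).
Variables (v1 : 'I_n1 -> M1) (v2 : 'I_n2 -> M2).

Lemma dnf_cons p l :
  dnf (p :: l) v1 v2 <-> (sat M1 p.1 v1 /\ sat M2 p.2 v2) \/ dnf l v1 v2.
Proof. by []. Qed.

Lemma dnf_cat l l' : dnf (l ++ l') v1 v2 <-> dnf l v1 v2 \/ dnf l' v1 v2.
Proof. by elim: l => [|p l IH] /=; [tauto|rewrite IH; tauto]. Qed.

Lemma dnf_topP : dnf dnf_top v1 v2.
Proof. by left; split=> -[]. Qed.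

Lemma dnf_conjP p q l : dnf (dnf_conj p q l) v1 v2 <->
  sat M1 p v1 /\ sat M2 q v2 /\ dnf l v1 v2.
Proof.
elim: l => [|r l IH]; first by split=> // -[_ []].
rewrite -[dnf_conj _ _ _]/((FAnd p r.1, FAnd q r.2) :: dnf_conj p q l).
by rewrite !dnf_cons IH (sat_and p) (sat_and q); tauto.
Qed.

Lemma dnf_notP l : dnf (dnf_not l) v1 v2 <-> ~ dnf l v1 v2.
Proof.
elim: l => [|p l IH]; first by split=> [_ []|_]; exact: dnf_topP.
rewrite [dnf_not _]/= dnf_cat !dnf_conjP !sat_not IH dnf_cons.
have T1 := @sat_top L1 M1 _ v1; have T2 := @sat_top L2 M2 _ v2.
by case: (pselect (sat M1 p.1 v1)) => H1; tauto.
Qed.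

End Dnf.

Lemma dnf_ex1 n1 n2 (l : seq (formula L1 n1.+1 * formula L2 n2))
    (M1 : structure L1) (M2 : structure L2) (v1 : 'I_n1 -> M1)
    (v2 : 'I_n2 -> M2) :
  dnf [seq (FEx r.1, r.2) | r <- l] v1 v2 <-> exists x, dnf l (vcons x v1) v2.
Proof.
elim: l => [|p l IH]; first by split=> // -[].
rewrite map_cons !dnf_cons IH (sat_ex p.1).
split=> [[[[x ?] ?]|[x ?]]|[x [[? ?]|?]]].
- by exists x; left.
- by exists x; right.
- by left; split=> //; exists x.
- by right; exists x.
Qed.

Lemma dnf_ex2 n1 n2 (l : seq (formula L1 n1 * formula L2 n2.+1))
    (M1 : structure L1) (M2 : structure L2) (v1 : 'I_n1 -> M1)
    (v2 : 'I_n2 -> M2) :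
  dnf [seq (r.1, FEx r.2) | r <- l] v1 v2 <-> exists x, dnf l v1 (vcons x v2).
Proof.
elim: l => [|p l IH]; first by split=> // -[].
rewrite map_cons !dnf_cons IH (sat_ex p.2).
split=> [[[? [x ?]]|[x ?]]|[x [[? ?]|?]]].
- by exists x; left.
- by exists x; right.
- by left; split=> //; exists x.
- by right; exists x.
Qed.

Definition du_var n (t : term L n) : 'I_n :=
  match t with TVar i => i | TFun f _ => match f with end end.

Lemma eval_du (M : structure L) n (v : 'I_n -> M) t :
  eval M v t = v (du_var t).
Proof. by case: t => // -[]. Qed.

(** The list is chosen before the structures: the same decomposition has to be read in the source
    and in the target of a map. *)
Definition fv_dnf n1 n2 (D : forall (M1 : structure L1) (M2 : structure L2),
    ('I_n1 -> M1) -> ('I_n2 -> M2) -> Prop) : Prop :=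
  exists l, forall M1 M2 v1 v2, D M1 M2 v1 v2 <-> dnf l v1 v2.

Lemma fv_true n1 n2 (D : forall (M1 : structure L1) (M2 : structure L2),
    ('I_n1 -> M1) -> ('I_n2 -> M2) -> Prop) :
  (forall M1 M2 v1 v2, D M1 M2 v1 v2) -> fv_dnf D.
Proof.
by move=> H; exists (dnf_top n1 n2) => *; split=> // _; exact: dnf_topP.
Qed.

Lemma fv_false n1 n2 (D : forall (M1 : structure L1) (M2 : structure L2),
    ('I_n1 -> M1) -> ('I_n2 -> M2) -> Prop) :
  (forall M1 M2 v1 v2, ~ D M1 M2 v1 v2) -> fv_dnf D.
Proof. by move=> H; exists [::] => *; split=> // /H. Qed.

Lemma fv_left n1 n2 (p : formula L1 n1)
    (D : forall (M1 : structure L1) (M2 : structure L2),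
       ('I_n1 -> M1) -> ('I_n2 -> M2) -> Prop) :
  (forall M1 M2 v1 v2, D M1 M2 v1 v2 <-> sat M1 p v1) -> fv_dnf D.
Proof.
move=> H; exists [:: (p, FTop L2 n2)] => M1 M2 v1 v2; rewrite H [dnf _ _ _]/=.
by have T := @sat_top L2 M2 _ v2; split=> [?|[[]|]//]; left.
Qed.

Lemma fv_right n1 n2 (p : formula L2 n2)
    (D : forall (M1 : structure L1) (M2 : structure L2),
       ('I_n1 -> M1) -> ('I_n2 -> M2) -> Prop) :
  (forall M1 M2 v1 v2, D M1 M2 v1 v2 <-> sat M2 p v2) -> fv_dnf D.
Proof.
move=> H; exists [:: (FTop L1 n1, p)] => M1 M2 v1 v2; rewrite H [dnf _ _ _]/=.
by have T := @sat_top L1 M1 _ v1; split=> [?|[[]|]//]; left.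
Qed.

(** The pattern alone decides whether all arguments lie in the part that [r] belongs to. If they do
    not, the relation is constantly false; otherwise it is a formula of that part, a graph becoming
    an equation and a part predicate a tautology. *)
Lemma fv_rel (r : rel_sym L) n1 n2 (s : 'I_(rel_ar r) -> 'I_n1 + 'I_n2) :
  fv_dnf (fun M1 M2 v1 v2 =>
    rel_int (du_structure M1 M2) r (merge v1 v2 \o s)).
Proof.
case: r s => [||r|r|f|f] s.
- case E: (s ord0) => [i|i]; [apply: fv_true|apply: fv_false] => M1 M2 v1 v2 /=.
    by exists (v1 i); rewrite E.
  by case=> a; rewrite E.
- case E: (s ord0) => [i|i]; [apply: fv_false|apply: fv_true] => M1 M2 v1 v2 /=.
    by case=> a; rewrite E.
  by exists (v2 i); rewrite E.
- case: (pselect (exists b, s = inl \o b)) => [[b ->]|H]; last first.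
    by apply: fv_false => M1 M2 v1 v2 [y E _]; apply: H; exact: merge_inl E.
  apply: (fv_left (p := rename (atom r) b)) => M1 M2 v1 v2.
  rewrite sat_rename; split=> [[y E]|Hv]; last by exists (v1 \o b).
  by rewrite -(comp_injI (@inl_inj _ _) E : v1 \o b = y).
- case: (pselect (exists b, s = inr \o b)) => [[b ->]|H]; last first.
    by apply: fv_false => M1 M2 v1 v2 [y E _]; apply: H; exact: merge_inr E.
  apply: (fv_right (p := rename (atom r) b)) => M1 M2 v1 v2.
  rewrite sat_rename; split=> [[y E]|Hv]; last by exists (v2 \o b).
  by rewrite -(comp_injI (@inr_inj _ _) E : v2 \o b = y).
- case: (pselect (exists b, s = inl \o b)) => [[b ->]|H]; last first.
    by apply: fv_false => M1 M2 v1 v2 [y E]; apply: H; exact: merge_inl E.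
  apply: (fv_left (p := FEq (TVar L1 (b ord0))
    (TFun (fun i => TVar L1 (b (lift ord0 i)))))) => M1 M2 v1 v2.
  split=> [[y E]|/= Hv].
    have {}E : v1 \o b = _ := comp_injI (@inl_inj _ _) E.
    rewrite /= -[LHS]/((v1 \o b) ord0) E vcons0; congr (fun_int M1 f _).
    by rewrite -(vcons_tail (fun_int M1 f y) y) -E.
  exists (v1 \o b \o lift ord0).
  have E := vcons_eta (v1 \o b); rewrite /= Hv in E.
  exact: (congr1 (fun u => inl \o u) E).
- case: (pselect (exists b, s = inr \o b)) => [[b ->]|H]; last first.
    by apply: fv_false => M1 M2 v1 v2 [y E]; apply: H; exact: merge_inr E.
  apply: (fv_right (p := FEq (TVar L2 (b ord0))
    (TFun (fun i => TVar L2 (b (lift ord0 i)))))) => M1 M2 v1 v2.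
  split=> [[y E]|/= Hv].
    have {}E : v2 \o b = _ := comp_injI (@inr_inj _ _) E.
    rewrite /= -[LHS]/((v2 \o b) ord0) E vcons0; congr (fun_int M2 f _).
    by rewrite -(vcons_tail (fun_int M2 f y) y) -E.
  exists (v2 \o b \o lift ord0).
  have E := vcons_eta (v2 \o b); rewrite /= Hv in E.
  exact: (congr1 (fun u => inr \o u) E).
Qed.

Lemma feferman_vaught n (phi : formula L n) n1 n2 (s : 'I_n -> 'I_n1 + 'I_n2) :
  fv_dnf (fun M1 M2 v1 v2 => sat (du_structure M1 M2) phi (merge v1 v2 \o s)).
Proof.
elim: n / phi n1 n2 s => [n|n t u|n r ts|n p IHp q IHq|n p IH] n1 n2 s.
- by apply: fv_false => M1 M2 v1 v2 [].
- suff [l Hl] : fv_dnf (fun (M1 : structure L1) (M2 : structure L2)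
      (v1 : 'I_n1 -> M1) (v2 : 'I_n2 -> M2) =>
      merge v1 v2 (s (du_var t)) = merge v1 v2 (s (du_var u))).
    by exists l => M1 M2 v1 v2; rewrite -Hl /= !eval_du.
  case: (s (du_var t)) => i; case: (s (du_var u)) => j; try by apply: fv_false.
    apply: (fv_left (p := FEq (TVar L1 i) (TVar L1 j))) => M1 M2 v1 v2 /=.
    by split=> [[]|->].
  apply: (fv_right (p := FEq (TVar L2 i) (TVar L2 j))) => M1 M2 v1 v2 /=.
  by split=> [[]|->].
- have [l Hl] := fv_rel (fun i => s (du_var (ts i))).
  exists l => M1 M2 v1 v2; rewrite -Hl /=.
  suff -> : (fun i => eval (du_structure M1 M2) (merge v1 v2 \o s) (ts i)) =
    merge v1 v2 \o (fun i => s (du_var (ts i))) by [].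
  by apply/funext => i; rewrite eval_du.
- have [l Hl] := IHp n1 n2 s; have [l' Hl'] := IHq n1 n2 s.
  exists (dnf_not l ++ l') => M1 M2 v1 v2.
  rewrite dnf_cat dnf_notP -Hl -Hl' sat_imp.
  case: (pselect (sat (du_structure M1 M2) p (merge v1 v2 \o s))); tauto.
(* The universal quantifier is read as the negation of an existential one, whose witness lies in the
   first part or in the second. *)
- have [l Hl] := IH _ _ (splitl s); have [l' Hl'] := IH _ _ (splitr s).
  exists (dnf_not ([seq (FEx r.1, r.2) | r <- dnf_not l] ++
    [seq (r.1, FEx r.2) | r <- dnf_not l'])) => M1 M2 v1 v2.
  rewrite dnf_notP dnf_cat dnf_ex1 dnf_ex2.
  split=> [H [[x]|[x]]|H x /=].
  + by rewrite dnf_notP -Hl merge_splitl => /(_ (H _)).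
  + by rewrite dnf_notP -Hl' merge_splitr => /(_ (H _)).
  + apply: contrapT => Hx; apply: H; case: x Hx => x Hx; [left|right].
      by exists x; rewrite dnf_notP -Hl merge_splitl.
    by exists x; rewrite dnf_notP -Hl' merge_splitr.
Qed.

Definition sum_map (A1 A2 B1 B2 : Type) (f1 : A1 -> B1) (f2 : A2 -> B2)
    (x : A1 + A2) : B1 + B2 :=
  match x with inl a => inl (f1 a) | inr a => inr (f2 a) end.

(** * Gluing and splitting maps between disjoint unions *)

Section Maps.
Variables (M1 N1 : structure L1) (M2 N2 : structure L2).
Local Notation M := (du_structure M1 M2).
Local Notation N := (du_structure N1 N2).

Lemma du_partial_elementary (A1 : set M1) (A2 : set M2) (f1 : M1 -> N1)
    (f2 : M2 -> N2) :
  partial_elementary A1 f1 -> partial_elementary A2 f2 ->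
  @partial_elementary L M N
    [set x | match x with inl a => A1 a | inr a => A2 a end] (sum_map f1 f2).
Proof.
move=> f1P f2P n phi v Av.
have [n1 [n2 [v1 [v2 [s [E H1 H2]]]]]] := split_valuation v.
have [l Hl] := feferman_vaught phi s.
have -> : sum_map f1 f2 \o v = merge (f1 \o v1) (f2 \o v2) \o s.
  by rewrite E; apply/funext => i /=; case: (s i).
rewrite E !Hl; have A1v i : A1 (v1 i).
  by have [j Hj] := H1 i; have := Av j; rewrite /= Hj.
have A2v i : A2 (v2 i) by have [j Hj] := H2 i; have := Av j; rewrite /= Hj.
elim: l {Hl} => [//|p l IH] /=.
by rewrite IH (f1P _ p.1 v1 A1v) (f2P _ p.2 v2 A2v).
Qed.

(** Preservation of the two part predicates keeps [f] on each side; formulas of one side are then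
    transferred through their relativizations. *)
Lemma du_partial_elementary_inv (A : set M) (f : M -> N) :
  @partial_elementary L M N A f -> exists (f1 : M1 -> N1) (f2 : M2 -> N2),
  [/\ @partial_elementary L1 M1 N1 [set a | A (inl a)] f1,
      @partial_elementary L2 M2 N2 [set a | A (inr a)] f2
    & forall x, A x -> f x = sum_map f1 f2 x].
Proof.
move=> fP.
have P1 a : A (inl a) -> exists b, f (inl a) = inl b.
  move=> Aa; have := fP _ (duP1 L1 L2) (fun=> inl a) (fun=> Aa).
  by case=> /(_ _)[|b Hb _]; [exists a|exists b].
have P2 a : A (inr a) -> exists b, f (inr a) = inr b.
  move=> Aa; have := fP _ (duP2 L1 L2) (fun=> inr a) (fun=> Aa).
  by case=> /(_ _)[|b Hb _]; [exists a|exists b].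
(* Off [A] the map [f] may change sides, whence the default values. *)
have [c1] := carrier_inhabited N1; have [c2] := carrier_inhabited N2.
pose f1 a := if f (inl a) is inl b then b else c1.
pose f2 a := if f (inr a) is inr b then b else c2.
have E1 a : A (inl a) -> f (inl a) = inl (f1 a).
  by move=> /P1[b]; rewrite /f1 => ->.
have E2 a : A (inr a) -> f (inr a) = inr (f2 a).
  by move=> /P2[b]; rewrite /f2 => ->.
exists f1, f2; split=> [n phi v Av|n phi v Av|[a|a] Aa /=]; last 2 first.
- by rewrite E1.
- by rewrite E2.
- rewrite -(sat_tr (du_interprets1 M1 M2)) -(sat_tr (du_interprets1 N1 N2)).
  have -> : inl \o (f1 \o v) = f \o (inl \o v).
    by apply/funext => i /=; rewrite E1 //; exact: Av.
  exact: fP.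
- rewrite -(sat_tr (du_interprets2 M1 M2)) -(sat_tr (du_interprets2 N1 N2)).
  have -> : inr \o (f2 \o v) = f \o (inr \o v).
    by apply/funext => i /=; rewrite E2 //; exact: Av.
  exact: fP.
Qed.

End Maps.
End FefermanVaught.

(** * Prime models of the disjoint union *)

Section PrimeModels.
Variable L : language.
Implicit Types (M N : structure L) (T : theory L).

Lemma elementary_models M N (f : M -> N) T :
  elementary f -> models M T <-> models N T.
Proof.
move=> fP; split=> H phi /H Hphi v.
  by rewrite (ffun0_eq v (f \o @vnil M)); apply/fP; exact: Hphi.
by apply/fP; exact: Hphi.
Qed.

Lemma elementary_comp M N (P : structure L) (f : M -> N) (g : N -> P) :
  elementary f -> elementary g -> elementary (g \o f).
Proof. by move=> fP gP n phi v; rewrite fP gP. Qed.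

Lemma prime_over_finite_iso T M N :
  isomorphic M N -> prime_over_finite T M -> prime_over_finite T N.
Proof.
move=> [f fiso] [MT [A finA Aprime]].
have fel := isomorphism_elementary fiso.
split; first by apply/(elementary_models _ fel).
have [[f' f'K fK] _ _] := fiso.
have f'el : elementary f'.
  move=> n phi v; rewrite (fel _ phi (f' \o v)).
  suff -> : f \o (f' \o v) = v by [].
  by apply/funext => i /=; rewrite fK.
exists (f @` A); first exact: finite_image.
move=> P h hP; have [] := Aprime P (h \o f).
  move=> n phi v Av; rewrite fel (hP _ phi (f \o v)) // => i.
  by exists (v i).
move=> g gel gA; exists (g \o f'); first exact: elementary_comp.
by move=> _ [a Aa <-] /=; rewrite f'K gA.
Qed.

Definition lrk T M (H : prime_over_finite T M) : LRK T :=
  \pi_(LRK T) (\pi_(RK T) (exist _ M H)).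

Lemma lrk_le T M N (HM : prime_over_finite T M) (HN : prime_over_finite T N) :
  (lrk HM <= lrk HN)%O <-> elem_embeddable M N.
Proof.
rewrite -(RK_leP (exist _ M HM) (exist _ N HN)).
by rewrite -[(_ <= _)%O]/(LRK_le _ _) /lrk LRK_leE.
Qed.

Definition lrk_repr T (x : LRK T) : structures (prime_over_finite T) :=
  repr (repr x).

Lemma lrk_reprK T (x : LRK T) : lrk (svalP (lrk_repr x)) = x.
Proof.
rewrite /lrk; have -> : exist _ _ (svalP (lrk_repr x)) = lrk_repr x.
  by case: (lrk_repr x) => M H; exact: eq_exist.
by rewrite /lrk_repr !reprK.
Qed.

Lemma lrk_repr_le T (x y : LRK T) : (x <= y)%O <->
  elem_embeddable (sval (lrk_repr x)) (sval (lrk_repr y)).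
Proof. by rewrite -{1}(lrk_reprK x) -{1}(lrk_reprK y); exact: lrk_le. Qed.

End PrimeModels.

(** * The order isomorphism between the product of LRK(T1) and LRK(T2) and LRK(T) *)

Section DisjointUnionLRK.
Variables (L1 L2 : language) (T1 : theory L1) (T2 : theory L2).
Local Notation T := (du_theory T1 T2).

Lemma du_elementary (M1 N1 : structure L1) (M2 N2 : structure L2)
    (f1 : M1 -> N1) (f2 : M2 -> N2) : elementary f1 -> elementary f2 ->
  @elementary _ (du_structure M1 M2) (du_structure N1 N2) (sum_map f1 f2).
Proof.
move=> f1el f2el n phi v.
apply: (@du_partial_elementary _ _ _ _ _ _ setT setT).
- by move=> m psi w _; exact: f1el.
- by move=> m psi w _; exact: f2el.
- by move=> i /=; case: (v i).
Qed.

Lemma du_prime_over_finite (M1 : structure L1) (M2 : structure L2) :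
  models M1 T1 -> models M2 T2 ->
  prime_over_finite T (du_structure M1 M2) <->
  prime_over_finite T1 M1 /\ prime_over_finite T2 M2.
Proof.
move=> M1T M2T; split=> [[_ [A finA Aprime]]|].
  split; split=> //.
  - exists [set a | A (inl a)].
      by apply: finite_preimage finA => x y _ _; exact: inl_inj.
    move=> N f fP.
    (* To test primeness of one part alone, the other part is mapped identically to itself. *)
    have idP : @partial_elementary L2 M2 M2 [set a | A (inr a)] id by [].
    have [] := Aprime (du_structure N M2) (sum_map f id).
      move=> n phi v Av; apply: (du_partial_elementary fP idP).
      by move=> i; have := Av i; rewrite /=; case: (v i).
    move=> g gel gA; have gP : partial_elementary setT g by move=> n phi v _.
    have [g1 [g2 [g1P _ gE]]] := du_partial_elementary_inv gP.
    exists g1 => [n phi v|a Aa]; first exact: g1P.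
    by have := gA _ Aa; rewrite gE //= => -[].
  - exists [set a | A (inr a)].
      by apply: finite_preimage finA => x y _ _; exact: inr_inj.
    move=> N f fP.
    have idP : @partial_elementary L1 M1 M1 [set a | A (inl a)] id by [].
    have [] := Aprime (du_structure M1 N) (sum_map id f).
      move=> n phi v Av; apply: (du_partial_elementary idP fP).
      by move=> i; have := Av i; rewrite /=; case: (v i).
    move=> g gel gA; have gP : partial_elementary setT g by move=> n phi v _.
    have [g1 [g2 [_ g2P gE]]] := du_partial_elementary_inv gP.
    exists g2 => [n phi v|a Aa]; first exact: g2P.
    by have := gA _ Aa; rewrite gE //= => -[].
move=> [[_ [A1 finA1 A1prime]] [_ [A2 finA2 A2prime]]].
split; first exact: models_du.
exists ((inl @` A1) `|` (inr @` A2)).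
  by rewrite finite_setU; split; exact: finite_image.
(* Sentences are the formulas of [fP] without variables, so [N] is elementarily equivalent to the
   disjoint union and therefore splits as one. *)
move=> N f fP; have NT : models N T.
  move=> phi Tphi v; rewrite (ffun0_eq v (f \o @vnil _)).
  by apply/fP; [case|exact: Tphi].
have [N1 [N2 [N1T N2T [h hiso]]]] := du_model_iso NT.
have hel := isomorphism_elementary hiso.
have [[h' h'K hK] _ _] := hiso.
have h'P : @partial_elementary _ (du_structure M1 M2) (du_structure N1 N2)
    ((inl @` A1) `|` (inr @` A2)) (h' \o f).
  move=> n phi v Av; rewrite fP // hel.
  suff -> : h \o (h' \o f \o v) = f \o v by [].
  by apply/funext => i /=; rewrite hK.
have [f1 [f2 [f1P f2P fE]]] := du_partial_elementary_inv h'P.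
have [|g1 g1el g1A] := A1prime N1 f1.
  by move=> n phi v Av; apply: f1P => i; left; exists (v i).
have [|g2 g2el g2A] := A2prime N2 f2.
  by move=> n phi v Av; apply: f2P => i; right; exists (v i).
exists (h \o sum_map g1 g2).
  exact: elementary_comp (du_elementary g1el g2el) hel.
move=> x Ax; rewrite -[RHS]hK -[h' (f x)]/((h' \o f) x) (fE x Ax) /=; congr h.
by case: Ax => -[a Aa <-] /=; rewrite ?g1A ?g2A.
Qed.

Lemma du_embeddable (M1 N1 : structure L1) (M2 N2 : structure L2) :
  elem_embeddable (du_structure M1 M2) (du_structure N1 N2) <->
  elem_embeddable M1 N1 /\ elem_embeddable M2 N2.
Proof.
split=> [[f fel]|[[f1 f1el] [f2 f2el]]].
  have fP : partial_elementary setT f by move=> n phi v _.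
  have [f1 [f2 [f1P f2P _]]] := du_partial_elementary_inv fP.
  by split; [exists f1 => n phi v; exact: f1P|exists f2 => n phi v; exact: f2P].
by exists (sum_map f1 f2); exact: du_elementary.
Qed.

Lemma du_lrk_repr (x : LRK T1) (y : LRK T2) :
  prime_over_finite T
    (du_structure (sval (lrk_repr x)) (sval (lrk_repr y))).
Proof.
have Hx := svalP (lrk_repr x); have Hy := svalP (lrk_repr y).
by apply/du_prime_over_finite; [case: Hx|case: Hy|].
Qed.

Definition du_lrk (x : LRK T1) (y : LRK T2) : LRK T := lrk (du_lrk_repr x y).

Lemma du_lrk_le x y x' y' :
  (du_lrk x y <= du_lrk x' y')%O = (x <= x')%O && (y <= y')%O.
Proof.
apply/idP/andP=> [/lrk_le/du_embeddable[]|[]] /lrk_repr_le H1 /lrk_repr_le H2.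
  by [].
by apply/lrk_le/du_embeddable.
Qed.

Lemma du_lrk_surj z : exists x y, z = du_lrk x y.
Proof.
have [NT _] := svalP (lrk_repr z).
have [M1 [M2 [M1T M2T iso]]] := du_model_iso NT.
have MP := prime_over_finite_iso (isomorphic_sym iso) (svalP (lrk_repr z)).
have [M1P M2P] := (proj1 (du_prime_over_finite M1T M2T) MP).
exists (lrk M1P), (lrk M2P); rewrite -[LHS]lrk_reprK.
(* The representative chosen for the class of [M] need not be [M]; mutual embeddability with it is
   all that the order sees. *)
have E (L : language) (S : theory L) M (H : prime_over_finite S M) :
    elem_embeddable M (sval (lrk_repr (lrk H))) /\
    elem_embeddable (sval (lrk_repr (lrk H))) M.
  split.
    by apply/(lrk_le H (svalP (lrk_repr (lrk H)))); rewrite lrk_reprK.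
  by apply/(lrk_le (svalP (lrk_repr (lrk H))) H); rewrite lrk_reprK.
have [E1 E1'] := E _ _ _ M1P; have [E2 E2'] := E _ _ _ M2P.
apply/le_anti/andP; split; apply/lrk_le.
  apply: elem_embeddable_trans (iso_elem_embeddable (isomorphic_sym iso)) _.
  exact/du_embeddable.
apply: elem_embeddable_trans (iso_elem_embeddable iso).
exact/du_embeddable.
Qed.

End DisjointUnionLRK.

(** * Countable elementary submodels *)

Lemma countable_inj (X : Type) (Y : countType) (f : X -> Y) :
  injective f -> countable [set: X].
Proof.
move=> fI; apply/countable_injP; exists (fun x => pickle (f x)) => x y _ _.
by move=> /(pcan_inj pickleK)/fI.
Qed.

Lemma countable_enum (X : Type) (A : set X) : countable A ->
  exists e : nat -> option X, forall x, A x -> exists n, e n = Some x.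
Proof.
move=> /countable_injP[f fI].
pose e n := match pselect (exists x, A x /\ f x = n) with
  | left H => Some (projT1 (cid H)) | right _ => None end.
exists e => x Ax; exists (f x); rewrite /e.
case: pselect => [H|[]]; last by exists x.
congr Some; have [Ay E] := projT2 (cid H).
by apply: fI => //; rewrite inE.
Qed.

Lemma countable_sigT (I : countType) (F : I -> Type) :
  (forall i, countable [set: F i]) -> countable [set: {i & F i}].
Proof.
move=> HF; have H i : exists f : F i -> nat, injective f.
  have /countable_injP[f fI] := HF i.
  by exists f => x y E; apply: fI; rewrite ?inE.
apply: (@countable_inj _ (I * nat)%type
  (fun p => (projT1 p, projT1 (cid (H (projT1 p))) (projT2 p)))).
by move=> [i x] [j y] /= [E]; case: j / E y => y /(projT2 (cid (H i))) ->.
Qed.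

Lemma map_enum_inj (X : Type) n (f g : 'I_n -> X) :
  [seq f i | i <- enum 'I_n] = [seq g i | i <- enum 'I_n] -> f = g.
Proof.
by move=> /eq_in_map E; apply/funext => i; apply: E; rewrite mem_enum.
Qed.

(** * Countability of the set of formulas *)

Section CountableFormulas.
Variables (L : language) (fc : fun_sym L -> nat) (rc : rel_sym L -> nat).
Hypotheses (fcI : injective fc) (rcI : injective rc).

(** Finite trees labelled by numbers form a countable type. The code does not record [n], since only
    terms in the same number of variables are compared. *)
Fixpoint term_code n (t : term L n) : GenTree.tree nat :=
  match t with
  | TVar i => GenTree.Leaf (i : nat)
  | TFun f ts =>
      GenTree.Node (fc f) [seq term_code (ts i) | i <- enum 'I_(fun_ar f)]
  end.

Fixpoint formula_code n (phi : formula L n) : GenTree.tree nat :=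
  match phi with
  | FBot _ => GenTree.Node 0 [::]
  | FEq _ s t => GenTree.Node 1 [:: term_code s; term_code t]
  | FRel _ r ts => GenTree.Node 2 (GenTree.Leaf (rc r) ::
      [seq term_code (ts i) | i <- enum 'I_(rel_ar r)])
  | FImp _ p q => GenTree.Node 3 [:: formula_code p; formula_code q]
  | FAll _ p => GenTree.Node 4 [:: formula_code p]
  end.

Lemma term_code_inj n : injective (@term_code n).
Proof.
elim=> [i|f ts IH] [j|g us] //=; first by case=> /val_inj ->.
case=> /fcI E; case: g / E us => us /map_enum_inj E.
by congr TFun; apply/funext => i; apply: IH; exact: (congr1 (@^~ i) E).
Qed.

Lemma formula_code_inj n : injective (@formula_code n).
Proof.
move=> p; elim: n / p => [n|n s t|n r ts|n p IHp q IHq|n p IH] u.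
- by case: n / u.
- by case: n / u s t => //= n s' t' s t [/term_code_inj -> /term_code_inj ->].
- case: n / u ts => //= n r' ts' ts [/rcI E]; case: r' / E ts' => ts'.
  move=> /map_enum_inj E; congr FRel; apply/funext => i.
  by apply: term_code_inj; exact: (congr1 (@^~ i) E).
- case: n / u p q IHp IHq => //= n p' q' p q IHp IHq [/IHp -> /IHq ->] //.
- by case: n / u p IH => //= n p' p IH [/IH ->].
Qed.

End CountableFormulas.

Lemma countable_formulas (L : language) n :
  countable_language L -> countable [set: formula L n].
Proof.
move=> [/countable_injP[fc fcI] /countable_injP[rc rcI]].
apply: (@countable_inj _ _ (@formula_code L fc rc n)); apply: formula_code_inj.
  by move=> f g E; apply: fcI; rewrite ?inE.
by move=> r s E; apply: rcI; rewrite ?inE.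
Qed.

Lemma dependent_choice (X : nat -> Type) (x0 : X 0%N)
    (R : forall j, X j -> X j.+1 -> Prop) :
  (forall j x, exists y, R j x y) ->
  exists f : forall j, X j, f 0%N = x0 /\ forall j, R j (f j) (f j.+1).
Proof.
move=> HR; pose f := fix f j : X j :=
  if j is j'.+1 then projT1 (cid (HR j' (f j'))) else x0.
by exists f; split=> // j; exact: (projT2 (cid (HR j (f j)))).
Qed.

(* In an extending chain of tuples, new entries are put in front, in accordance
   with vcons. *)
Definition extending (X : Type) k (c : forall j, 'I_(j + k) -> X) : Prop :=
  forall j, exists x, c j.+1 = vcons x (c j).

(** Entries are added in front, so indices shift by [j - i]. This explicit value determines [s],
    which lets [chain_model] name the inclusion of a stage by its shift alone. *)
Lemma extending_incl (X : Type) k (c : forall j, 'I_(j + k) -> X) i j :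
  extending c -> (i <= j)%N -> exists s : 'I_(i + k) -> 'I_(j + k),
    (forall l, s l = l + (j - i) :> nat) /\ c i = c j \o s.
Proof.
move=> cE; elim: j => [|j IH].
  by rewrite leqn0 => /eqP ->; exists id; split=> // l; rewrite addn0.
rewrite leq_eqVlt => /orP[/eqP ->|].
  by exists id; split=> // l; rewrite subnn addn0.
rewrite ltnS => ij; have [s [Hs E]] := IH ij; exists (lift ord0 \o s); split.
  by move=> l; rewrite /= /bump /= Hs subSn // addnS.
by have [x ->] := cE j; rewrite compA vcons_tail.
Qed.

Lemma extending_tuple (X : Type) k (c : forall j, 'I_(j + k) -> X) n
    (u : 'I_n -> X) :
  extending c -> (forall i, exists j l, c j l = u i) ->
  exists j (s : 'I_n -> 'I_(j + k)), u = c j \o s.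
Proof.
move=> cE; elim: n u => [|n IH] u Hu.
  by exists 0%N, (@vnil _); exact: ffun0_eq.
have [j [s Hs]] := IH (u \o lift ord0) (fun i => Hu (lift ord0 i)).
have [j' [l Hl]] := Hu ord0.
have [t [_ Ht]] := extending_incl cE (leq_maxl j j').
have [t' [_ Ht']] := extending_incl cE (leq_maxr j j').
exists (maxn j j'), (vcons (t' l) (t \o s)).
by rewrite (vcons_eta u) Hs Ht comp_vcons -Hl Ht'.
Qed.

(** * Elementary submodels as limits of chains of tuples *)

Section TarskiVaught.
Variable (L : language).

Lemma elementary_inj (M N : structure L) (f : M -> N) :
  elementary f -> injective f.
Proof.
move=> fel x y E.
have := fel _ (FEq (TVar L ord0) (TVar L (lift ord0 ord0)))
  (vcons x (vcons y (@vnil M))).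
by rewrite /= !vcons0 !vconsS !vcons0 E => -[_]; apply.
Qed.

(** Besides giving elementarity, the criterion makes [S] nonempty when applied to a valid formula,
    and closed under the operations when applied to the equation between variable 0 and the value of
    an operation. *)
Lemma tarski_vaught (M : structure L) (S : set M) :
  (forall n (p : formula L n.+1) (u : 'I_n -> M), (forall i, S (u i)) ->
     (exists x, sat M p (vcons x u)) ->
     exists2 x, S x & sat M p (vcons x u)) ->
  exists (N : structure L) (f : N -> M), elementary f /\ S = range f.
Proof.
move=> TV; pose X := {x : M | S x}.
have XS n (u : 'I_n -> X) i : S (sval (u i)) by exact: (svalP (u i)).
have [|x0 Sx0 _] := TV _ (FTop L 1) (@vnil M)
  (fun i => match notF (ltn_ord i) with end).
  by have [x] := carrier_inhabited M; exists x; exact: sat_top.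
have /choice[F HF] : forall p : {f : fun_sym L & 'I_(fun_ar f) -> X},
    exists x : X, sval x = fun_int M (projT1 p) (fun i => sval (projT2 p i)).
  move=> [f u] /=.
  have [|x Sx] := TV _
      (FEq (TVar L ord0) (TFun (fun i => TVar L (lift ord0 i))))
      (fun i => sval (u i)) (XS _ u).
    exists (fun_int M f (fun i => sval (u i))) => /=; rewrite vcons0.
    by congr (fun_int M f _); apply/funext => i; rewrite vconsS.
  rewrite /= vcons0 => E; exists (exist _ x Sx) => /=; rewrite E.
  by congr (fun_int M f _); apply/funext => i; rewrite vconsS.
pose N := @Structure L X (inhabits (exist _ x0 Sx0))
  (fun f u => F (existT _ f u)) (fun r u => rel_int M r (fun i => sval (u i))).
have evalE n (v : 'I_n -> N) t :
    sval (eval N v t) = eval M (fun i => sval (v i)) t.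
  elim: t => [//|f ts IH] /=; rewrite HF /=.
  by congr (fun_int M f _); apply/funext => i; rewrite IH.
exists N, (fun x : X => sval x); split; last first.
  apply/seteqP; split=> [x Sx|_ [x _ <-]]; last exact: svalP.
  by exists (exist _ x Sx).
move=> n p v; elim: n / p v => [n|n s t|n r ts|n p IHp q IHq|n p IH] v.
- by [].
- rewrite /= -!evalE; split=> [-> //|].
  by case: (eval N v s) (eval N v t) => [x Sx] [y Sy] /= E; exact: eq_exist.
- rewrite /=; suff -> : (fun i => sval (eval N v (ts i))) =
    (fun i => eval M (fun i => sval (v i)) (ts i)) by [].
  by apply/funext => i; rewrite evalE.
- by rewrite /= -/sat IHp IHq.
- split=> /= H x; last by apply/IH; rewrite comp_vcons; exact: H.
  apply: contrapT => Hx.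
  have [|y Sy] := TV _ (FNot p) (fun i => sval (v i)) (XS _ v).
    by exists x.
  apply; have := H (exist _ y Sy); rewrite IH.
  by rewrite (comp_vcons (fun x : X => sval x)).
Qed.

(** A Henkin construction inside [M]: every satisfiable formula over a stage eventually receives a
    witness, chosen so as to preserve the invariant [Q]. A trivial [Q] yields the Löwenheim-Skolem
    theorem; with [Q] saying that the type of the stage over [a] is isolated, the limit is atomic
    over [a]. *)
Lemma chain_model (M : structure L) k (a : 'I_k -> M)
    (Q : forall j, ('I_(j + k) -> M) -> Prop) :
  countable_language L -> Q 0%N a ->
  (forall j v (p : formula L (j + k).+1), Q j v ->
     (exists x, sat M p (vcons x v)) ->
     exists2 x, sat M p (vcons x v) & Q j.+1 (vcons x v)) ->
  exists (N : structure L) (f : N -> M) (d : forall j, 'I_(j + k) -> N),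
  [/\ elementary f, f \o d 0%N = a, extending d,
      forall y, exists j i, d j i = y & forall j, Q j (f \o d j)].
Proof.
move=> cL Qa Qstep.
have [e He] : exists e : nat -> option {j & formula L (j + k).+1},
    forall r, exists n, e n = Some r.
  have := @countable_enum {j & formula L (j + k).+1} setT.
  case=> [|e He]; last by exists e => r; exact: He.
  by apply: countable_sigT => j; exact: countable_formulas.
(* logn 2 takes each value infinitely often, so each requirement is met again
   at arbitrarily late stages. *)
pose task J j (p : formula L (j + k).+1) (v : 'I_(J + k) -> M) (x : M) :=
  forall s : 'I_(j + k) -> 'I_(J + k),
    (forall l, s l = l + (J - j) :> nat) ->
    (exists y, sat M p (vcons y (v \o s))) -> sat M p (vcons x (v \o s)).
pose R J (v : {v : 'I_(J + k) -> M | Q J v})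
    (w : {w : 'I_(J.+1 + k) -> M | Q J.+1 w}) :=
  exists2 x, sval w = vcons x (sval v) &
    if e (logn 2 J) is Some r then task J (projT1 r) (projT2 r) (sval v) x
    else True.
have [|c [c0 cR]] := @dependent_choice (fun J => {v : 'I_(J + k) -> M | Q J v})
    (exist _ a Qa) R.
  move=> J [v Qv]; have [y0] := carrier_inhabited M.
  have [x Qx Hx] : exists2 x, Q J.+1 (vcons x v) &
      if e (logn 2 J) is Some r then task J (projT1 r) (projT2 r) v x else True.
    (* When no formula is due, a witness of a valid formula extends the chain within [Q]. *)
    have [|x0 _ Qx0] := Qstep J v (FTop L _) Qv.
      by exists y0; exact: sat_top.
    case: (e _) => [[j p]|]; last by exists x0.
    case: (pselect (exists s : 'I_(j + k) -> 'I_(J + k),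
      (forall l, s l = l + (J - j) :> nat) /\
      (exists y, sat M p (vcons y (v \o s))))); last first.
      by move=> H; exists x0 => //= s sE Hs; case: H; exists s.
    move=> [s [sE [y Hy]]].
    have [|x Hx Qx] := Qstep J v (rename p (lift_ren s)) Qv.
      by exists y; rewrite sat_rename vcons_lift_ren.
    exists x => //= s' s'E _; have -> : s' = s.
      by apply/funext => l; apply: val_inj; rewrite /= s'E sE.
    by move: Hx; rewrite sat_rename vcons_lift_ren.
  by exists (exist _ (vcons x v) Qx); exists x.
pose d J := sval (c J).
have dE : extending d by move=> J; have [x Hx _] := cR J; exists x.
have dTV n (p : formula L n.+1) (u : 'I_n -> M) :
    (forall i, exists j l, d j l = u i) -> (exists x, sat M p (vcons x u)) ->
    exists2 x, (exists j l, d j l = x) & sat M p (vcons x u).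
  move=> /(extending_tuple dE)[j [s Es]] Hex.
  have [r Hr] := He (existT _ j (rename p (lift_ren s))).
  (* A stage of 2-adic valuation [r] that is at least [j]: it treats requirement [r] when the
     parameters of the formula are already present. *)
  pose J := (2 ^ r * (2 * j).+1)%N.
  have rJ : logn 2 J = r.
    by rewrite lognM ?expn_gt0 // pfactorK // lognE /= dvdn2 /= oddM addn0.
  have jJ : (j <= J)%N.
    by rewrite /J mulnS mul2n -addnn; apply: leq_trans (leq_addl _ _);
      apply: leq_trans (leq_pmull _ _); rewrite ?expn_gt0 ?leq_addr.
  have [t [tE Ht]] := extending_incl dE jJ.
  have [x Ex] := cR J; rewrite rJ Hr /= => /(_ t tE).
  rewrite -/(d J) -Ht => Hx; exists x.
    by exists J.+1, ord0; rewrite /d Ex vcons0.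
  move: Hx; rewrite sat_rename vcons_lift_ren -Es; apply.
  by case: Hex => y Hy; exists y; rewrite sat_rename vcons_lift_ren -Es.
have [N [f [fel Sf]]] := tarski_vaught dTV.
have fI := elementary_inj fel.
have /choice[g Hg] : forall p : {j & 'I_(j + k)},
    exists y, f y = d (projT1 p) (projT2 p).
  move=> [j l] /=.
  have : range f (d j l) by rewrite -Sf; exists j, l.
  by case=> y _ <-; exists y.
exists N, f, (fun j l => g (existT _ j l)).
have fg j : f \o (fun l => g (existT _ j l)) = d j.
  by apply/funext => l; rewrite /= Hg.
split=> //.
- by rewrite fg /d c0.
- move=> j; have [x Ex] := dE j.
  exists (g (existT _ j.+1 ord0)); apply/funext => l; apply: fI.
  rewrite -[LHS]/((f \o (fun l => g (existT _ j.+1 l))) l) fg.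
  rewrite -[RHS]/((f \o vcons _ _) l) comp_vcons fg Ex; congr (vcons _ _ l).
  by rewrite Hg /= Ex vcons0.
- move=> y; have : range f (f y) by exists y.
  rewrite -Sf => -[j [l E]]; exists j, l; apply: fI.
  by rewrite Hg /= E.
- by move=> j; rewrite fg; exact: (svalP (c j)).
Qed.

End TarskiVaught.

(** * Atomic models *)

Section Atomic.
Variable L : language.
Implicit Types M N : structure L.

Definition same_type M N n (v : 'I_n -> M) (w : 'I_n -> N) : Prop :=
  forall p, sat M p v <-> sat N p w.

(* The type of v over its subtuple v \o t is isolated. *)
Definition isolated M k n (t : 'I_k -> 'I_n) (v : 'I_n -> M) : Prop :=
  exists2 chi, sat M chi v & forall p, sat M p v ->
    forall u, u \o t = v \o t -> sat M chi u -> sat M p u.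

(** Stated for one new element over a tuple that contains [a], which is the form a back-and-forth
    step consumes. *)
Definition atomic_over M k (a : 'I_k -> M) : Prop :=
  forall n (t : 'I_k -> 'I_n) (v : 'I_n -> M) x, v \o t = a ->
  exists2 chi, sat M chi (vcons x v) & forall p, sat M p (vcons x v) ->
    forall y, sat M chi (vcons y v) -> sat M p (vcons y v).

Lemma isolated_elementary M N (f : M -> N) k n (t : 'I_k -> 'I_n)
    (v : 'I_n -> M) : elementary f -> isolated t (f \o v) -> isolated t v.
Proof.
move=> fel [chi chiv H]; exists chi; first exact/fel.
move=> p /fel/H Hp u E /fel Hu; apply/fel; apply: Hp Hu.
by rewrite -compA E.
Qed.

Lemma extending_base (X : Type) k (c : forall j, 'I_(j + k) -> X) j :
  extending c -> c j \o @rshift j k = c 0%N.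
Proof.
move=> cE; elim: j => [|j <-].
  by apply/funext => i; congr (c 0%N); exact: val_inj.
have [x ->] := cE j; apply/funext => i /=; rewrite -[RHS](vconsS x).
by congr (vcons _ _ _); exact: val_inj.
Qed.

(** Every finite tuple lies in a stage, and a projection of an isolated type is isolated by the
    projected formula. *)
Lemma chain_atomic M k (d : forall j, 'I_(j + k) -> M) :
  extending d -> (forall y, exists j i, d j i = y) ->
  (forall j, isolated (@rshift j k) (d j)) -> atomic_over (d 0%N).
Proof.
move=> dE dS dI n t v x vt.
have [|j [s E]] := @extending_tuple _ _ d _ (vcons x v) dE; first by move=> i.
have [chi Hchi chiP] := dI j.
(* The formula [chi] isolates only among tuples with base [d 0]. Since [v] contains [d 0] along [t],
   this restriction can be written as equations between variables. *)
pose base := FAnds (fun i : 'I_k => FEq (TVar L (@rshift j k i))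
  (TVar L (s (lift ord0 (t i))))).
have baseP (w : 'I_(j + k) -> M) y : w \o s = vcons y v ->
    sat M base w <-> w \o @rshift j k = d 0%N.
  move=> Ew; have Ei i : w (s (lift ord0 (t i))) = d 0%N i.
    by rewrite -[LHS]/((w \o s) _) Ew vconsS -vt.
  rewrite sat_ands -vt; split=> [H|H i /=].
    by apply/funext => i; have := H i; rewrite /= Ei -vt.
  by rewrite Ei -vt -H.
exists (FProj s (FAnd chi base)).
  apply/sat_proj; exists (d j) => //; apply/sat_and; split=> //.
  by apply/(baseP _ x); [rewrite E|exact: extending_base].
move=> p; rewrite E -sat_rename => /chiP Hp y /sat_proj[w].
move=> /sat_and[Hw /baseP Hb] Ew; rewrite -Ew -sat_rename; apply: Hp Hw.
by rewrite (Hb _ Ew) extending_base.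
Qed.

(** That [chi] implies [p] is itself a formula about [v], so it carries over to [w]; any witness of
    [chi] over [w] then realizes the whole type. *)
Lemma forth M N k (a : 'I_k -> M) n (t : 'I_k -> 'I_n) (v : 'I_n -> M)
    (w : 'I_n -> N) x :
  atomic_over a -> v \o t = a -> same_type v w ->
  exists y, same_type (vcons x v) (vcons y w).
Proof.
move=> Ma vt vw; have [chi Hchi chiP] := Ma _ _ _ x vt.
have /vw/sat_ex[y Hy] : sat M (FEx chi) v by apply/sat_ex; exists x.
have H p : sat M p (vcons x v) -> sat N p (vcons y w).
  move=> /chiP Hp; have /vw : sat M (FAll (FImp chi p)) v by exact: Hp.
  by move=> /(_ y); apply.
exists y => p; split; first exact: H.
by move=> Hp; apply: contrapT => /(H (FNot p)); apply.
Qed.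

Lemma pair_chain M N k (c : forall j, 'I_(j + k) -> M * N) :
  extending c -> (forall j, same_type (fst \o c j) (snd \o c j)) ->
  (forall x, exists j l, (c j l).1 = x) ->
  exists2 g : M -> N, elementary g & forall j l, g (c j l).1 = (c j l).2.
Proof.
move=> cE cT cS.
have tupleP n (u : 'I_n -> M * N) : (forall i, exists j l, c j l = u i) ->
    same_type (fst \o u) (snd \o u).
  move=> /(extending_tuple cE)[j [s ->]] p.
  by have := cT j (rename p s); rewrite !sat_rename.
have /choice[g Hg] : forall x, exists y, exists j l, c j l = (x, y).
  move=> x; have [j [l E]] := cS x; exists (c j l).2, j, l.
  by rewrite -E; case: (c j l).
have gP n (v : 'I_n -> M) : same_type v (g \o v).
  by apply: (tupleP _ (fun i => (v i, g (v i)))) => i; exact: Hg.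
exists g => [n p v|j l]; first exact: gP.
(* Two pairs of the chain with equal first coordinates: the formula equating variables 0 and 1
   transfers to second coordinates, so the value chosen for [g] is the only possible one. *)
have := tupleP _ (vcons ((c j l).1, g (c j l).1) (vcons (c j l) (@vnil _))).
rewrite !comp_vcons /=.
case/(_ _ (FEq (TVar L ord0) (TVar L (lift ord0 ord0)))).
  move=> i; case: (unliftP ord0 i) => [i'|] ->; last first.
    by rewrite vcons0; exact: Hg.
  by rewrite vconsS (ord1 i') vcons0; exists j, l.
by rewrite /= !vcons0 !vconsS !vcons0 => /(_ erefl).
Qed.

Lemma elementary_bij_isomorphism M N (f : M -> N) :
  elementary f -> (forall y, exists x, f x = y) -> isomorphism f.
Proof.
move=> fel fS; split.
- rewrite -setTT_bijective; split=> [//|x y _ _|y _].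
    exact: elementary_inj.
  by have [x <-] := fS y; exists x.
- move=> g x; have := fel _ (FEq (TVar L ord0)
    (TFun (fun i => TVar L (lift ord0 i)))) (vcons (fun_int M g x) x).
  have tailE (X : Type) y (u : 'I_(fun_ar g) -> X) :
      (fun i => vcons y u (lift ord0 i)) = u by exact: vcons_tail.
  by rewrite comp_vcons /= !vcons0 !tailE => -[/(_ erefl)].
- by move=> r x; exact: (fel _ (FRel (fun i => TVar L i)) x).
Qed.

Lemma countable_surj M : countable [set: M] ->
  exists e : nat -> M, forall x, exists n, e n = x.
Proof.
move=> /countable_enum[e He]; have [x0] := carrier_inhabited M.
exists (fun n => odflt x0 (e n)) => x.
by have [n Hn] := He x I; exists n; rewrite Hn.
Qed.

(** Going forth along an enumeration of [M] uses atomicity of [M] only, so the target [N] may be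
    arbitrary. *)
Lemma atomic_prime_over M k (a : 'I_k -> M) :
  countable [set: M] -> atomic_over a -> prime_over (range a).
Proof.
move=> /countable_surj[e eS] Ma N f fP.
pose X j := {p : 'I_(j + k) -> M * N |
  same_type (fst \o p) (snd \o p) /\ (fst \o p) \o @rshift j k = a}.
have X0 : same_type (fst \o (fun i => (a i, f (a i))))
    (snd \o (fun i => (a i, f (a i)))) /\
    (fst \o (fun i => (a i, f (a i)))) \o @rshift 0 k = a.
  split; first by move=> p; apply: fP => i; exists i.
  by apply/funext => i /=; congr a; exact: val_inj.
pose R j (p : X j) (q : X j.+1) :=
  exists2 y, sval q = vcons (e j, y) (sval p) & True.
have [|c [c0 cR]] := @dependent_choice X (exist _ _ X0) R.
  move=> j [p [pT pa]]; have [y Hy] := forth (e j) Ma pa pT.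
  have Hq : same_type (fst \o vcons (e j, y) p) (snd \o vcons (e j, y) p) /\
      (fst \o vcons (e j, y) p) \o @rshift j.+1 k = a.
    rewrite !comp_vcons; split=> //; rewrite -[RHS]pa.
    apply/funext => i; rewrite /= -[RHS](vconsS (e j) (fst \o p)).
    by congr (vcons _ _ _); exact: val_inj.
  pose q : X j.+1 := exist _ (vcons (e j, y) p) Hq.
  by exists q, y.
have [||x|g gel gc] := @pair_chain M N k (fun j => sval (c j)).
- by move=> j; have [y -> _] := cR j; exists (e j, y).
- by move=> j; case: (svalP (c j)).
- have [j <-] := eS x; exists j.+1, ord0.
  by have [y -> _] := cR j; rewrite vcons0.
exists g => // _ [i _ <-].
by have := gc 0%N i; rewrite c0.
Qed.

Lemma back_and_forth M N : countable [set: M] -> countable [set: N] ->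
  atomic_over (@vnil M) -> atomic_over (@vnil N) ->
  same_type (@vnil M) (@vnil N) -> isomorphic M N.
Proof.
move=> /countable_surj[e eS] /countable_surj[e' e'S] Ma Na MN.
pose X j := {p : 'I_(j + 0) -> M * N | same_type (fst \o p) (snd \o p)}.
have X0 : same_type (fst \o @vnil (M * N)) (snd \o @vnil (M * N)).
  by rewrite (ffun0_eq (fst \o _) (@vnil M)) (ffun0_eq (snd \o _) (@vnil N)).
(* Even stages exhaust [M] and odd stages exhaust [N]; [j./2] runs through both enumerations. *)
pose R j (p : X j) (q : X j.+1) := exists z, sval q = vcons z (sval p) /\
  if odd j then z.2 = e' j./2 else z.1 = e j./2.
pose z0 : X 0%N := exist _ (@vnil (M * N)) X0.
have [|c [_ cR]] := @dependent_choice X z0 R.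
  move=> j [p pT]; rewrite /R /=; case: (odd j).
    have pT' : same_type (snd \o p) (fst \o p) by move=> q; rewrite pT.
    have [x Hx] := forth (e' j./2) Na (ffun0_eq (_ \o @vnil _) _) pT'.
    have Hq : same_type (fst \o vcons (x, e' j./2) p)
        (snd \o vcons (x, e' j./2) p).
      by rewrite !comp_vcons => q; rewrite Hx.
    pose q : X j.+1 := exist _ (vcons (x, e' j./2) p) Hq.
    by exists q, (x, e' j./2).
  have [y Hy] := forth (e j./2) Ma (ffun0_eq (_ \o @vnil _) _) pT.
  have Hq : same_type (fst \o vcons (e j./2, y) p)
      (snd \o vcons (e j./2, y) p).
    by rewrite !comp_vcons.
  pose q : X j.+1 := exist _ (vcons (e j./2, y) p) Hq.
  by exists q, (e j./2, y).
have [||x|g gel gc] := @pair_chain M N 0 (fun j => sval (c j)).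
- by move=> j; have [z [-> _]] := cR j; exists z.
- by move=> j; exact: (svalP (c j)).
- have [j <-] := eS x; exists j.*2.+1, ord0.
  by have [z [->]] := cR j.*2; rewrite odd_double doubleK vcons0.
exists g; apply: elementary_bij_isomorphism => // y.
have [j <-] := e'S y; have [z [Ez]] := cR j.*2.+1.
rewrite /= odd_double /= uphalf_double => <-; exists z.1.
by have := gc j.*2.+2 ord0; rewrite Ez vcons0.
Qed.

Lemma extending_countable (X : Type) k (d : forall j, 'I_(j + k) -> X) :
  (forall y, exists j i, d j i = y) -> countable [set: X].
Proof.
move=> dS; have /choice[f fP] : forall y, exists p : {j & 'I_(j + k)},
    d (projT1 p) (projT2 p) = y.
  by move=> y; have [j [i <-]] := dS y; exists (existT _ j i).
apply: (@countable_inj _ _ f) => x y E.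
by rewrite -(fP x) E fP.
Qed.

Lemma loewenheim_skolem M k (a : 'I_k -> M) : countable_language L ->
  exists (N : structure L) (f : N -> M) (b : 'I_k -> N),
    [/\ elementary f, countable [set: N] & f \o b = a].
Proof.
move=> cL; have [j v p _ [x Hx]|N [f [d [fel fd dE dS _]]]] :=
  @chain_model L M k a (fun _ _ => True) cL I.
  by exists x.
exists N, f, (d 0%N); split=> //; exact: extending_countable dS.
Qed.

End Atomic.

(** * Ultrapowers *)

Section Ultrapower.
Variables (L : language) (M : structure L) (U : set_system nat).
Hypothesis UU : UltraFilter U.

Let UF : ProperFilter U := ultra_proper.

Lemma filter_all m (A : 'I_m -> set nat) :
  (forall i, U (A i)) -> U [set k | forall i, A i k].
Proof.
elim: m A => [|m IH] A HA.
  by apply: filterS filterT => k _ [].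
apply: filterS (filterI (HA ord0) (IH _ (fun i => HA (lift ord0 i)))).
by move=> k [A0 AS] i; case: (unliftP ord0 i) => [j|] ->.
Qed.

Lemma ultra_imp (A B : set nat) : U [set k | A k -> B k] <-> (U A -> U B).
Proof.
split=> [H HA|H]; first by apply: filterS (filterI H HA) => k [AB /AB].
case: (in_ultra_setVsetC A UU) => [/H|]; apply: filterS => k.
  by move=> Bk.
by move=> nA /nA.
Qed.

(* A predicate and not a "set", whose universe is too large for a carrier. *)
Let germ (f : nat -> M) : (nat -> M) -> Prop := fun g => U [set k | f k = g k].

Let germ_eq f g : germ f = germ g <-> U [set k | f k = g k].
Proof.
split=> [E|Ufg].
  by rewrite -[U _]/(germ f g) E; apply: filterS filterT.
apply/funext => h; apply/propext.
split=> Uh; apply: filterS (filterI Ufg Uh) => k [] /=.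
  by move=> -> ->.
by move=> -> ->.
Qed.

Let carrier_U := {A : (nat -> M) -> Prop | exists f, A = germ f}.

Let cls (f : nat -> M) : carrier_U := exist _ (germ f) (ex_intro _ f erefl).

Let cls_eq f g : cls f = cls g <-> U [set k | f k = g k].
Proof.
rewrite -germ_eq; split=> [|E]; first by case.
exact: eq_exist.
Qed.

Let rep (A : carrier_U) : nat -> M := projT1 (cid (svalP A)).

Let repK A : cls (rep A) = A.
Proof.
case: A => A HA; apply: eq_exist => /=; rewrite /rep.
by case: cid => f /= ->.
Qed.

Lemma inhabited_carrier_U : inhabited carrier_U.
Proof. by have [x] := carrier_inhabited M; exists; exact: (cls (fun=> x)). Qed.

Definition ultrapower : structure L := @Structure L carrier_U
  inhabited_carrier_U
  (fun g u => cls (fun k => fun_int M g (fun i => rep (u i) k)))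
  (fun r u => U [set k | rel_int M r (fun i => rep (u i) k)]).

Definition ultra_class (f : nat -> M) : ultrapower := cls f.

Lemma rep_class f : U [set k | rep (cls f) k = f k].
Proof. by apply/cls_eq; rewrite repK. Qed.

Lemma los n (p : formula L n) (v : 'I_n -> nat -> M) :
  sat ultrapower p (fun i => ultra_class (v i)) <->
  U [set k | sat M p (fun i => v i k)].
Proof.
(* Symbols are interpreted through chosen representatives; finitely many of these agree with the
   given functions simultaneously on a set of [U]. *)
have repE m (w : 'I_m -> nat -> M) :
    U [set k | (fun i => rep (cls (w i)) k) = (fun i => w i k)].
  apply: filterS (filter_all (fun i => rep_class (w i))) => k Hk.
  exact/funext.
have evalE m (w : 'I_m -> nat -> M) t :
    eval ultrapower (fun i => ultra_class (w i)) t =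
    ultra_class (fun k => eval M (fun i => w i k) t).
  elim: t => [//|g ts IH] /=; apply/cls_eq.
  apply: filterS (repE _ (fun i k => eval M (fun i => w i k) (ts i))) => k E.
  rewrite /= -E; congr (fun_int M g _); apply/funext => i.
  by rewrite IH.
elim: n / p v => [n|n s t|n r ts|n p IHp q IHq|n p IH] v.
- split=> //= H; apply: (filter_not_empty U).
  by apply: filterS H => k.
- by rewrite /= !evalE cls_eq.
- rewrite -[sat _ _ _]/(rel_int ultrapower r (fun i => eval _ _ (ts i))).
  rewrite (funext (fun i => evalE _ v (ts i))) /=.
  have H := repE _ (fun i k => eval M (fun j => v j k) (ts i)).
  by split=> H'; apply: filterS (filterI H H') => k [/= ->].
- by rewrite [X in U X]/([set k | _ -> _]) ultra_imp -IHp -IHq.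
- have vE x : vcons (ultra_class x) (fun i => ultra_class (v i)) =
      fun i => ultra_class (vcons x v i).
    exact/esym/(comp_vcons ultra_class).
  have vE' x k : (fun i => vcons x v i k) = vcons (x k) (fun i => v i k).
    exact: (comp_vcons (fun f : nat -> M => f k)).
  rewrite sat_all; split=> [H|H y]; last first.
    rewrite -(repK y) vE IH; apply: filterS H => k /= /(_ (rep y k)).
    by rewrite vE'.
  have [//|HC] :=
    in_ultra_setVsetC [set k | sat M (FAll p) (fun i => v i k)] UU.
  have /choice[x Hx] : forall k, exists x,
      ~ sat M (FAll p) (fun i => v i k) -> ~ sat M p (vcons x (fun i => v i k)).
    move=> k; case: (pselect (sat M (FAll p) (fun i => v i k))) => Hk.
      by have [x0] := carrier_inhabited M; exists x0.
    by move/existsNP: (Hk) => [x Hx]; exists x.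
  exfalso; apply: (filter_not_empty U).
  have := H (ultra_class x); rewrite vE IH => H'.
  apply: filterS (filterI HC H') => k [/= Hk]; rewrite vE' => Hk'.
  exact: Hx Hk Hk'.
Qed.

End Ultrapower.

(** Compactness for a sequence of formulas: [p i] holds of [v k] for every k from [i] on, and [U]
    contains every set of eventually all indices, so the class of the sequence [v] satisfies all of
    them. *)
Lemma realize (L : language) (M : structure L) n (p : nat -> formula L n)
    (v : nat -> 'I_n -> M) :
  (forall i j, (i <= j)%N -> sat M (p i) (v j)) ->
  exists (N : structure L) (w : 'I_n -> N),
    same_type (@vnil M) (@vnil N) /\ forall i, sat N (p i) w.
Proof.
move=> H; have [U [UU evU]] := ultraFilterLemma eventually_filter.
have UF : ProperFilter U by exact: ultra_proper.
exists (ultrapower M U), (fun i => @ultra_class L M U (fun k => v k i)); split.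
  move=> q; rewrite (ffun0_eq (@vnil (ultrapower M U))
    (fun i => @ultra_class L M U (fun=> @vnil M i))) los.
  split=> [Hq|Hq]; first by apply: filterS filterT.
  by apply: contrapT => Hn; apply: (filter_not_empty U); apply: filterS Hq => k.
move=> i; apply/los; apply: filterS (evU [set k | (i <= k)%N] _).
  by move=> k /= /H.
by exists i.
Qed.

(** * Theories with finitely many countable models *)

Section Density.
Variable L : language.
Implicit Types M N : structure L.

(** All complete types consistent with the theory of [M], including those omitted in [M]: the type
    produced in [isolated_dense] is realized in an ultrapower. *)
Definition types_of M n : set (formula L n -> Prop) :=
  [set tp | exists N (w : 'I_n -> N),
     same_type (@vnil M) (@vnil N) /\ tp = (fun p => sat N p w)].

Arguments types_of M n _ : clear implicits.

Definition small M : Prop := forall n, countable (types_of M n).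

(* If no isolated type contains phi, repeatedly splitting phi yields a
   decreasing sequence of formulas that avoids every type of a given countable
   list, whereas a realization of the whole sequence has a type in the list. *)
Lemma isolated_dense M k n (t : 'I_k -> 'I_n) (a : 'I_k -> M)
    (phi : formula L n) :
  countable (types_of M n) -> (exists v, v \o t = a /\ sat M phi v) ->
  exists v, [/\ v \o t = a, sat M phi v & isolated t v].
Proof.
move=> /countable_enum[e He] Hphi; apply: contrapT => Hn.
(* The formulas carry no parameters. The tuple [a] enters only through the demand that some
   realization extend it, so a list of the types over the empty set is enough. *)
pose X := {p : formula L n | (exists v, v \o t = a /\ sat M p v) /\
  forall u, sat M p u -> sat M phi u}.
pose R j (p q : X) := (forall u, sat M (sval q) u -> sat M (sval p) u) /\
  forall tp, types_of M n tp -> e j = Some tp -> ~ tp (sval q).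
have Xphi : (exists v, v \o t = a /\ sat M phi v) /\
  forall u, sat M phi u -> sat M phi u by [].
have [|c [_ cR]] := @dependent_choice (fun=> X) (exist _ phi Xphi) R.
  move=> j [p [[v [vt pv]] pphi]].
  (* Without such a [psi], the formula [p] itself would isolate the type of [v] over [a]. *)
  have [psi [psiv [u [ut pu npsiu]]]] : exists psi, sat M psi v /\
      exists u, [/\ u \o t = a, sat M p u & ~ sat M psi u].
    apply: contrapT => H; apply: Hn; exists v; split=> //; first exact: pphi.
    exists p => // psi Hpsi u; rewrite vt => ut pu.
    by apply: contrapT => Hu; apply: H; exists psi; split=> //; exists u.
  have H1 : (exists v, v \o t = a /\ sat M (FAnd p psi) v) /\
      forall u, sat M (FAnd p psi) u -> sat M phi u.
    split; first by exists v; split=> //; apply/sat_and.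
    by move=> w /sat_and[/pphi].
  have H2 : (exists v, v \o t = a /\ sat M (FAnd p (FNot psi)) v) /\
      forall u, sat M (FAnd p (FNot psi)) u -> sat M phi u.
    split; first by exists u; split=> //; apply/sat_and.
    by move=> w /sat_and[/pphi].
  pose q1 : X := exist _ _ H1; pose q2 : X := exist _ _ H2.
  case: (pselect (exists tp, [/\ types_of M n tp, e j = Some tp &
      tp (FAnd p psi)])) => [[tp [tpM Etp Htp]]|H].
    exists q2; split; first by move=> w /sat_and[].
    move=> tp' _; rewrite Etp => -[<-]; move: tpM Htp => [N [w [_ ->]]].
    by move=> /sat_and[_ Hw] /sat_and[_]; apply.
  exists q1; split; first by move=> w /sat_and[].
  by move=> tp tpM Etp Htp; apply: H; exists tp.
have c_mono i j u : (i <= j)%N -> sat M (sval (c j)) u -> sat M (sval (c i)) u.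
  elim: j => [|j IH]; first by rewrite leqn0 => /eqP ->.
  rewrite leq_eqVlt => /orP[/eqP -> //|]; rewrite ltnS => /IH H Hu.
  by apply: H; exact: (cR j).1.
have /choice[v Hv] : forall j, exists v, sat M (sval (c j)) v.
  by move=> j; have [[v [_ Hv]] _] := svalP (c j); exists v.
have [|N [w [MN Hw]]] := @realize L M n (fun j => sval (c j)) v.
  by move=> i j ij; exact: c_mono ij (Hv j).
have [|j Ej] := He (fun p => sat N p w); first by exists N, w.
by apply: (cR j).2 Ej _; [exists N, w|exact: Hw].
Qed.

Lemma prime_model_over M k (a : 'I_k -> M) :
  countable_language L -> small M ->
  exists N (f : N -> M) (b : 'I_k -> N),
    [/\ elementary f, countable [set: N], atomic_over b & f \o b = a].
Proof.
move=> cL Msmall.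
pose Q j (v : 'I_(j + k) -> M) :=
  v \o @rshift j k = a /\ isolated (@rshift j k) v.
have r0 : @rshift 0 k = id by apply/funext => i; exact: val_inj.
have [||N [f [d [fel fd dE dS dQ]]]] := @chain_model L M k a Q cL.
- split; rewrite r0 //; exists (FTop L k); first exact: sat_top.
  by move=> p ap u E _; have -> : u = a by exact: E.
- move=> j v p [va [chi chiv chiP]] [x px].
  pose t := @rshift j.+1 k.
  have tE : t = lift ord0 \o @rshift j k by apply/funext => i; exact: val_inj.
  have [|u [ua /sat_and[pu chiu] [chi' chi'u chi'P]]] :=
    @isolated_dense M _ _ t a (FAnd p (rename chi (lift ord0))) (Msmall _).
    exists (vcons x v); rewrite sat_and sat_rename vcons_tail; split=> //.
    by rewrite tE compA vcons_tail.
  (* The tail of [u] may differ from [v], but it satisfies [chi] over [a] and so has the type of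
     [v]. Hence [v] too extends to a realization of [p] and [chi'], and [chi'] isolates its type. *)
  rewrite sat_rename in chiu.
  have /sat_ex[y /sat_and[Hp Hchi']] : sat M (FEx (FAnd p chi')) v.
    apply: contrapT => H.
    have /sat_not : sat M (FNot (FEx (FAnd p chi'))) (u \o lift ord0).
      by apply: chiP => //; rewrite va -ua tE compA.
    apply; apply/sat_ex; exists (u ord0); rewrite -vcons_eta.
    exact/sat_and.
  have yva : vcons y v \o t = a by rewrite tE compA vcons_tail.
  exists y => //; split=> //; exists chi' => // psi Hpsi w.
  rewrite yva -ua; apply: (chi'P); apply: contrapT => Hu.
  have := chi'P (FNot psi) Hu (vcons y v).
  by rewrite yva ua => /(_ erefl Hchi' Hpsi).
exists N, f, (d 0%N); split=> //; first exact: extending_countable dS.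
apply: chain_atomic => // j; apply: isolated_elementary fel _.
exact: (dQ j).2.
Qed.

End Density.

Lemma countable_range (X Y : Type) (f : X -> Y) :
  countable [set: X] -> countable (range f).
Proof. by move=> cX; apply: sub_countable (card_image_le _ _) cX. Qed.

Lemma countable_tuples (X : Type) n :
  countable [set: X] -> countable [set: 'I_n -> X].
Proof.
move=> /countable_injP[f fI].
apply: (@countable_inj _ {ffun 'I_n -> nat} (fun u => [ffun i => f (u i)])).
move=> u v /ffunP E; apply/funext => i; apply: fI; rewrite ?inE //.
by have := E i; rewrite !ffunE.
Qed.

Lemma finite_range (X : Type) (A : set X) : finite_set A ->
  exists k (a : 'I_k -> X), A = range a.
Proof.
elim/Pchoice: X => X in A *; move=> /finite_seqP[s ->].
exists (size s), (tnth (in_tuple s)); apply/seteqP; split=> [x xs|].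
  by have /tnthP[i ->] : x \in in_tuple s by []; exists i.
by move=> _ [i _ <-] /=; exact: mem_tnth.
Qed.

(** * Countable models, their types and LRK(T) *)

Section FiniteSpectrum.
Variables (L : language) (T : theory L).
Hypotheses (cL : countable_language L) (cT : complete_theory T).
Implicit Types M N : structure L.

Lemma models_same_type M N :
  models M T -> models N T -> same_type (@vnil M) (@vnil N).
Proof.
move=> MT NT.
suff H M' N' phi : models M' T -> models N' T ->
    sat M' phi (@vnil M') -> sat N' phi (@vnil N') by move=> p; split; exact: H.
move=> M'T N'T Hphi; have [_ /(_ phi)[H|H]] := cT; first exact: H.
by case: (H _ M'T (@vnil M')).
Qed.

Lemma same_type_models M N :
  models M T -> same_type (@vnil M) (@vnil N) -> models N T.
Proof.
move=> MT MN phi /MT Hphi v; rewrite (ffun0_eq v (@vnil N)).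
exact/MN/Hphi.
Qed.

Lemma iso_types_eq (P : structure L -> Prop) (M N : structures P) :
  \pi_(iso_types P) M = \pi_(iso_types P) N <-> isomorphic (sval M) (sval N).
Proof.
split=> [/eqquotP|MN]; first by move/asboolP.
by apply/eqquotP/asboolP.
Qed.

(** By Löwenheim-Skolem every type is realized in a countable model, and there are finitely many of
    these up to isomorphism, each with countably many tuples. *)
Lemma finite_I_small M : finite_I T -> models M T -> small M.
Proof.
move=> fI MT n.
pose R (X : countable_iso_types T) := sval (repr X).
pose F X := range (fun u : 'I_n -> R X => fun p => sat (R X) p u).
apply: (@sub_countable _ _ _ (\bigcup_X F X)).
  apply: subset_card_le => _ [N [w [MN ->]]].
  have NT := same_type_models MT MN.
  have [N' [f [b [fel cN' fb]]]] := loewenheim_skolem w cL.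
  have N'T : models N' T by apply/(elementary_models T fel).
  pose S : structures (countable_model T) := exist _ N' (conj N'T cN').
  have /iso_types_eq[h /isomorphism_elementary hel] :
    \pi_(countable_iso_types T) S =
      \pi_(countable_iso_types T) (repr (\pi_(countable_iso_types T) S)).
    by rewrite reprK.
  exists (\pi_(countable_iso_types T) S) => //; exists (h \o b) => //.
  by apply/funext => p; apply/propext; rewrite -fb -hel fel.
apply: bigcup_countable; first exact: finite_set_countable.
move=> X _; apply/countable_range/countable_tuples.
by have [] := svalP (repr X).
Qed.

Lemma atomic_prime_over_finite M k (a : 'I_k -> M) :
  models M T -> countable [set: M] -> atomic_over a -> prime_over_finite T M.
Proof.
move=> MT cM Ma; split=> //; exists (range a); last exact: atomic_prime_over.
exact/finite_image/finite_finset.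
Qed.

(** A model prime over a finite set embeds into a countable elementary submodel containing that set;
    outside the set the map [g] inverting the inclusion is arbitrary. *)
Lemma prime_over_finite_countable M :
  prime_over_finite T M -> countable [set: M].
Proof.
move=> [MT [A /finite_range[k [a ->]] Aprime]].
have [N [f [b [fel cN fb]]]] := loewenheim_skolem a cL.
have /choice[g Hg] : forall x, exists y, range a x -> f y = x.
  move=> x; case: (pselect (range a x)) => [[i _ <-]|H].
    by exists (b i); rewrite -fb.
  by have [y] := carrier_inhabited N; exists y.
have [|h hel _] := Aprime N g.
  move=> n phi v Av; rewrite fel; suff -> : f \o (g \o v) = v by [].
  by apply/funext => i /=; rewrite Hg.
have /countable_injP[c cI] := cN.
apply: (@countable_inj _ nat (c \o h)) => x y /= E.
by apply: (elementary_inj hel); apply: cI; rewrite ?inE.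
Qed.

Hypothesis fI : finite_I T.

Lemma exists_atomic_model :
  exists M, [/\ models M T, countable [set: M] & atomic_over (@vnil M)].
Proof.
have [[M0 M0T] _] := cT.
have [M [f [b [fel cM Mb _]]]] :=
  prime_model_over (@vnil M0) cL (finite_I_small fI M0T).
exists M; split=> //; first exact/(elementary_models T fel).
by rewrite (ffun0_eq (@vnil M) b).
Qed.

Lemma LRK_inhabited : inhabited (LRK T).
Proof.
have [M [MT cM Ma]] := exists_atomic_model; constructor.
exact: (lrk (atomic_prime_over_finite MT cM Ma)).
Qed.

Lemma countable_iso_types_trivial :
  (forall x y : LRK T, x = y) <-> (forall X Y : countable_iso_types T, X = Y).
Proof.
split=> [H X Y|H x y]; last first.
  rewrite -(lrk_reprK x) -(lrk_reprK y); apply/Order.POrderTheory.le_anti/andP.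
  set Mx := lrk_repr x; set My := lrk_repr y.
  have [Hx Hy] := (svalP Mx, svalP My).
  pose X : structures (countable_model T) :=
    exist _ (sval Mx) (conj Hx.1 (prime_over_finite_countable Hx)).
  pose Y : structures (countable_model T) :=
    exist _ (sval My) (conj Hy.1 (prime_over_finite_countable Hy)).
  have /iso_types_eq XY :
    \pi_(countable_iso_types T) X = \pi_(countable_iso_types T) Y by exact: H.
  split; apply/lrk_le/iso_elem_embeddable => //.
  exact: isomorphic_sym.
have [M0 [M0T cM0 M0a]] := exists_atomic_model.
have M0P := atomic_prime_over_finite M0T cM0 M0a.
suff Hiso (N : structures (countable_model T)) : isomorphic (sval N) M0.
  rewrite -(reprK X) -(reprK Y); apply/iso_types_eq.
  exact: isomorphic_trans (Hiso _) (isomorphic_sym (Hiso _)).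
case: N => N [/= NT cN].
apply: back_and_forth => //; last exact: models_same_type.
move=> n t v x _.
have [N' [f [b [fel cN' bA fb]]]] :=
  prime_model_over (vcons x v) cL (finite_I_small fI NT).
have N'T : models N' T by apply/(elementary_models T fel).
have N'P := atomic_prime_over_finite N'T cN' bA.
have [g gel] : elem_embeddable N' M0.
  by apply/(lrk_le N'P M0P); rewrite (H (lrk N'P) (lrk M0P)).
have [chi Hchi chiP] := M0a n (@vnil _) (g \o (b \o lift ord0)) (g (b ord0))
  (ffun0_eq _ _).
(* The common elementary submodel [N'] gives [vcons x v] in [N] the same type as its image in [M0],
   so isolation found in [M0] is read back in [N]. *)
have bE p : sat M0 p (vcons (g (b ord0)) (g \o (b \o lift ord0))) <->
    sat N p (vcons x v).
  by rewrite -fb -fel gel -comp_vcons -vcons_eta.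
exists chi; first exact/bE.
move=> p /bE/chiP Hp.
have : sat M0 (FAll (FImp chi p)) (g \o (b \o lift ord0)) by exact: Hp.
by rewrite -gel fel compA fb vcons_tail.
Qed.

(** Excludes 0, so that the minimum of two such numbers is 1 exactly when one of them is 1. *)
Lemma I_omega_gt0 : (0 < I_omega T)%N.
Proof.
have [M [MT cM _]] := exists_atomic_model.
pose S : structures (countable_model T) := exist _ M (conj MT cM).
rewrite /I_omega finmap.cardfs_gt0; apply/finmap.fset0Pn.
by exists (\pi_(countable_iso_types T) S); rewrite in_fset_set ?inE.
Qed.

Lemma I_omega_eq1 : I_omega T = 1%N <-> forall x y : LRK T, x = y.
Proof.
rewrite countable_iso_types_trivial; split=> [/eqP|H].
  move=> /finmap.cardfs1P[X EX] Y Z.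
  have inX W : W = X.
    apply/eqP; rewrite -finmap.in_fset1 -EX in_fset_set //.
    by rewrite inE.
  by rewrite (inX Y) (inX Z).
have := I_omega_gt0; rewrite /I_omega finmap.cardfs_gt0.
move=> /finmap.fset0Pn[X _]; apply/eqP/finmap.cardfs1P; exists X.
apply/finmap.fsetP => Y; rewrite finmap.in_fset1 in_fset_set // (H Y X) eqxx.
exact: mem_set.
Qed.

End FiniteSpectrum.

Theorem theorem4p2 (L1 L2 : language) (T1 : theory L1) (T2 : theory L2)
    (cL1 : countable_language L1) (cL2 : countable_language L2)
    (cT1 : complete_theory T1) (cT2 : complete_theory T2)
    (fT1 : finite_I T1) (fT2 : finite_I T2) :
  let T := du_theory T1 T2 in
  ((is_lattice (LRK T) <-> is_lattice (LRK T1) /\ is_lattice (LRK T2)) /\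
   (is_boolean_lattice (LRK T) <->
      is_boolean_lattice (LRK T1) /\ is_boolean_lattice (LRK T2))) /\
  (linearly_ordered (LRK T) <->
     [/\ linearly_ordered (LRK T1), linearly_ordered (LRK T2)
       & minn (I_omega T1) (I_omega T2) = 1]).
Proof.
move=> T.
have [a0] := LRK_inhabited cL1 cT1 fT1; have [b0] := LRK_inhabited cL2 cT2 fT2.
have mk_le := @du_lrk_le L1 L2 T1 T2; have mk_surj := @du_lrk_surj L1 L2 T1 T2.
split; [split|].
- exact: is_lattice_mk mk_le mk_surj a0 b0.
- exact: is_boolean_lattice_mk mk_le mk_surj a0 b0.
rewrite (linearly_ordered_mk mk_le mk_surj a0 b0).
have I1 := I_omega_gt0 cL1 cT1 fT1; have I2 := I_omega_gt0 cL2 cT2 fT2.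
have minE : minn (I_omega T1) (I_omega T2) = 1 <->
    (forall x y : LRK T1, x = y) \/ (forall x y : LRK T2, x = y).
  rewrite -(I_omega_eq1 cL1 cT1 fT1) -(I_omega_eq1 cL2 cT2 fT2).
  rewrite /minn; case: ltnP => H12; split=> [->|[E|E]]; auto.
  - by apply/eqP; rewrite eqn_leq I1 -ltnS -E (leq_trans H12).
  - by apply/eqP; rewrite eqn_leq I2 -E H12.
by split=> -[H1 H2 /minE H12].
Qed.
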